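(* The polynomials that are both quasi-key and Young quasi-key polynomials are precisely the $\hat{\mathfrak Q}_a$ such that $a$ is a number of equal parts followed by zeros, or a sequence of $1$'s and $2$'s followed by zeros, or $a$ has no zero parts and consecutive parts differ by at most $1$.
   Context: Weak compositions have length $n$. The quasi-key polynomial $\mathfrak Q_a$ (Assaf–Searles) is the generating function of fillings of the diagram of $a$ (row $i$ has $a_i$ left-justified boxes) such that entries weakly decrease along rows, no entry in row $i$ exceeds $i$, entries strictly increase up the first column and are distinct within each column, and every triple is an inversion triple: a type A triple is boxes $z,x$ adjacent in a row ($z$ left) with $y$ above $x$ in a higher row, the lower row weakly longer; a type B triple is $z,x$ adjacent in a row with $y$ below $z$ in a lower row, the higher row strictly longer; it is an inversion triple unless $z\ge y\ge x$. The Young quasi-key polynomial is $\hat{\mathfrak Q}_a(x_1,\ldots,x_n)=\mathfrak Q_{\mathrm{rev}(a)}(x_n,\ldots,x_1)$, where $\mathrm{rev}(a)$ is $a$ reversed. *)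

(* Defs.v *)
From mathcomp Require Import all_boot all_algebra.
From mathcomp Require Import mpoly.

Set Implicit Arguments.
Unset Strict Implicit.
Unset Printing Implicit Defensive.

Local Open Scope ring_scope.

(* Weak compositions of length n are n-tuples of naturals.  Rows, columns and
   entries are all numbered from 0 (row i below stands for the usual row i + 1,
   entry v for v + 1, 'X_i for x_{i+1}); rows are numbered from bottom to top. *)

Section QuasiKey.

Variables (n : nat) (a : n.-tuple nat).

Definition box : finType := {i : 'I_n & 'I_(tnth a i)}.

Definition row (b : box) : 'I_n := tag b.
Definition col (b : box) : nat := tagged b.

(* Entries range over 'I_n since an entry in row i is at most i. *)
Definition filling : finType := {ffun box -> 'I_n}.

Definition adjacent (z x : box) : bool :=
  (row x == row z) && (col x == (col z).+1).

(* The box y is in the column of x, in a higher row than z and x. *)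
Definition typeA (z x y : box) : bool :=
  [&& adjacent z x, col y == col x, (row x < row y)%N
    & (tnth a (row y) <= tnth a (row x))%N].

(* The box y is in the column of z, in a lower row than z and x. *)
Definition typeB (z x y : box) : bool :=
  [&& adjacent z x, col y == col z, (row y < row z)%N
    & (tnth a (row y) < tnth a (row z))%N].

Definition inversion_triple (T : filling) (z x y : box) : bool :=
  ~~ ((T y <= T z)%N && (T x <= T y)%N).

Definition quasikey_filling (T : filling) : bool :=
  [&& [forall b : box, forall c : box,
         (row b == row c) && (col b <= col c)%N ==> (T c <= T b)%N],
      [forall b : box, (T b <= row b)%N],
      [forall b : box, forall c : box,
         [&& col b == 0%N, col c == 0%N & (row b < row c)%N]
           ==> (T b < T c)%N],
      [forall b : box, forall c : box,
         (b != c) && (col b == col c) ==> (T b != T c)]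
    & [forall z : box, forall x : box, forall y : box,
         typeA z x y || typeB z x y ==> inversion_triple T z x y]].

Definition quasikey : {mpoly int[n]} :=
  \sum_(T : filling | quasikey_filling T) \prod_(b : box) 'X_(T b).

End QuasiKey.

Definition young_quasikey (n : nat) (a : n.-tuple nat) : {mpoly int[n]} :=
  quasikey [tuple of rev a] \mPo [tuple 'X_(rev_ord i) | i < n].

Definition equal_parts_then_zeros (s : seq nat) : Prop :=
  exists m k j : nat, s = nseq m k ++ nseq j 0%N.

Definition ones_twos_then_zeros (s : seq nat) : Prop :=
  exists (t : seq nat) (j : nat),
    all (fun p => (p == 1%N) || (p == 2%N)) t /\ s = t ++ nseq j 0%N.

Definition no_zero_small_steps (s : seq nat) : Prop :=
  0%N \notin s /\ sorted (fun p q => (p <= q.+1)%N && (q <= p.+1)%N) s.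

(* Main.v *)
Require Import Defs.
From mathcomp Require Import all_boot all_algebra.
From mathcomp Require Import mpoly.
From mathcomp Require Import perm zify.
Import Defs GRing.Theory.

Set Implicit Arguments.
Unset Strict Implicit.
Unset Printing Implicit Defensive.

(* Write rev for x_i -> x_{n-1-i}; the question is when Q_b = rev Q_e, where
   e = rev c for the Young quasi-key polynomial of c.

   Sufficiency.  With no zeros and small steps the only filling has every row
   constant.  Otherwise a filling is determined by its column sets, and it is
   enough to reverse fillings.  For a rectangle, sort the columns into a reverse
   semistandard tableau, rotate it by 180 degrees, and rearrange its columns.
   For parts 1 and 2, the rows are noncrossing intervals, and one lists them by
   left instead of right endpoints.

   Necessity.  The monomial x^{rev e} of Q_b and the monomial x^{rev b} of Q_e
   are extremal for dominance, which forces a filling with content rev e to have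
   constant rows, so the nonzero parts of e are those of b in reverse order.
   Filling the i-th nonzero row by i shows that all zeros of b and e are at the
   beginning.  Finally two explicit fillings exclude steps larger than 1 and, in
   the presence of a zero, steps between m and m + 1 with m >= 2. *)

(** * Fillings as arrays *)

(** A filling as a total array, [F i l] being the entry in row [i] and column [l]; its values
    outside the diagram are arbitrary. In [qk_A] the triple is z = (i, l), x = (i, l.+1), y = (r,
    l.+1); in [qk_B] it is z = (r, l), x = (r, l.+1), y = (i, l). *)
Record qkarray (a : nat -> nat) (F : nat -> nat -> nat) : Prop := QKArray {
  qk_row : forall i l, l.+1 < a i -> F i l.+1 <= F i l;
  qk_le : forall i l, l < a i -> F i l <= i;
  qk_col0 : forall i r, i < r -> 0 < a i -> 0 < a r -> F i 0 < F r 0;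
  qk_neq : forall i r l, i < r -> l < a i -> l < a r -> F i l <> F r l;
  qk_A : forall i r l, i < r -> l.+1 < a i -> l.+1 < a r -> a r <= a i ->
    ~ (F r l.+1 <= F i l /\ F i l.+1 <= F r l.+1);
  qk_B : forall i r l, i < r -> l.+1 < a r -> l < a i -> a i < a r ->
    ~ (F i l <= F r l /\ F r l.+1 <= F i l) }.

Lemma qk_row_le a F i l l' : qkarray a F -> l <= l' -> l' < a i -> F i l' <= F i l.
Proof.
move=> V; elim: l' => [|l' IH]; first by rewrite leqn0 => /eqP->.
rewrite leq_eqVlt => /orP[/eqP->//|]; rewrite ltnS => ll' l'a.
exact: leq_trans (qk_row V l'a) (IH ll' (ltnW l'a)).
Qed.

Lemma qk_inj a F i r l : qkarray a F -> l < a i -> l < a r -> F i l = F r l -> i = r.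
Proof.
move=> V li lr e; case: (ltngtP i r) => [h|h|//].
  by have /(_ e) := qk_neq V h li lr.
by have /(_ (esym e)) := qk_neq V h lr li.
Qed.

(** The type B condition carries the inequality to the next entry of the longer row, and the shorter
    row can only decrease. *)
Lemma qk_noncross a F i r l :
  qkarray a F -> i < r -> a i < a r -> l < a i -> F i l < F r l.
Proof.
move=> V ir ar; elim: l => [|l IH] la.
  by apply: (qk_col0 V) => //; lia.
have := IH (ltnW la); have := qk_row V la.
have := qk_B V ir (ltn_trans la ar) (ltnW la) ar; lia.
Qed.

Lemma qkarray_ext a F G :
  (forall i l, l < a i -> F i l = G i l) -> qkarray a F -> qkarray a G.
Proof.
move=> FG V; split=> [i l h|i l h|i r h h1 h2|i r l h h1 h2|i r l h h1 h2 h3|i r l h h1 h2 h3];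
  rewrite -!FG ?(ltnW h1) ?(ltnW h) //.
- exact: (qk_row V h).
- exact: (qk_le V h).
- exact: (qk_col0 V h h1 h2).
- exact: (qk_neq V h h1 h2).
- exact: (qk_A V h h1 h2 h3).
- exact: (qk_B V h h1 h2 h3).
Qed.

Lemma qk_const a : qkarray a (fun i _ => i).
Proof. by split=> //; lia. Qed.

(** * Fillings are determined by their column sets *)

Lemma qk_eq_col0 a F G i :
    qkarray a F -> qkarray a G ->
    (forall v, (exists i, 0 < a i /\ F i 0 = v) <-> (exists i, 0 < a i /\ G i 0 = v)) ->
  0 < a i -> F i 0 = G i 0.
Proof.
move=> VF VG FG; elim/ltn_ind: i => i IH ai.
case: (ltngtP (F i 0) (G i 0)) => // h.
- have [|r [ar e]] := (FG (F i 0)).1; first by exists i.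
  case: (ltngtP r i) => ri; last by subst r; lia.
  + by have := IH r ri ar; rewrite e => /(qk_inj VF ar ai); lia.
  + by have := qk_col0 VG ri ai ar; lia.
- have [|r [ar e]] := (FG (G i 0)).2; first by exists i.
  case: (ltngtP r i) => ri; last by subst r; lia.
  + by have := IH r ri ar; rewrite e => /(qk_inj VG ai ar); lia.
  + by have := qk_col0 VF ri ai ar; lia.
Qed.

(* The largest entry of column [l.+1] placed differently by [F] and [G] would
   violate a triple condition in the filling that puts it in the higher row. *)
Lemma qk_eq_step_lt a F G l d r r' :
    qkarray a F -> qkarray a G -> (forall i, l < a i -> F i l = G i l) ->
    (forall i i', l.+1 < a i -> l.+1 < a i' -> d < F i l.+1 ->
       F i l.+1 = G i' l.+1 -> i = i') ->
    (forall v, (exists i, l.+1 < a i /\ F i l.+1 = v) ->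
       exists i, l.+1 < a i /\ G i l.+1 = v) ->
    l.+1 < a r -> l.+1 < a r' -> F r l.+1 = d -> G r' l.+1 = d -> r' < r -> False.
Proof.
move=> VF VG FG IH sub ar ar' Fr Gr' r'r.
have ne := qk_neq VF r'r ar' ar.
have [i [ai e]] := sub _ (ex_intro _ r' (conj ar' erefl)).
have := qk_row VG ar'; rewrite -FG ?(ltnW ar') // Gr' => dF.
case: (ltnP d (F r' l.+1)) => h.
  have E := IH r' i ar' ai h (esym e); subst i; lia.
case: (leqP (a r) (a r')) => c.
  by apply: (qk_A VF r'r ar' ar c); rewrite Fr.
have := qk_noncross VF r'r c (ltnW ar').
have := qk_B VF r'r ar (ltnW ar') c; lia.
Qed.

Lemma qk_eq_step a F G l n :
    qkarray a F -> qkarray a G -> (forall i, n <= i -> a i = 0) ->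
    (forall i, l < a i -> F i l = G i l) ->
    (forall v, (exists i, l.+1 < a i /\ F i l.+1 = v) <->
               (exists i, l.+1 < a i /\ G i l.+1 = v)) ->
  forall i, l.+1 < a i -> F i l.+1 = G i l.+1.
Proof.
move=> VF VG an FG sets.
(* Downward induction on the entry; [k] bounds its distance from [n], which no entry reaches. *)
have main k : forall i i', l.+1 < a i -> l.+1 < a i' -> n <= F i l.+1 + k ->
    F i l.+1 = G i' l.+1 -> i = i'.
  elim: k => [|k IH] i i' ai ai' hk e.
    have := qk_le VF ai; case: (leqP n i) => [/an|]; lia.
  have IH' j j' : l.+1 < a j -> l.+1 < a j' -> F i l.+1 < F j l.+1 ->
      F j l.+1 = G j' l.+1 -> j = j'.
    by move=> aj aj' lt; apply: IH => //; lia.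
  have IH2 j j' : l.+1 < a j -> l.+1 < a j' -> F i l.+1 < G j l.+1 ->
      G j l.+1 = F j' l.+1 -> j = j'.
    by move=> aj aj' lt e'; apply/esym/IH => //; lia.
  case: (ltngtP i i') => // h.
  - have GF j : l < a j -> G j l = F j l by move=> /FG.
    by case: (qk_eq_step_lt VG VF GF IH2 (fun v => (sets v).2) ai' ai (esym e) erefl h).
  - by case: (qk_eq_step_lt VF VG FG IH' (fun v => (sets v).1) ai ai' erefl (esym e) h).
move=> i ai; have [i' [ai' e]] := (sets (F i l.+1)).1 (ex_intro _ i (conj ai erefl)).
by rewrite -e; congr (G _ _); apply/esym/(main n) => //; rewrite leq_addl.
Qed.

(** Columns are recovered from left to right: the first is increasing, and each later one is forced
    by its set and the column before it. *)
Lemma qk_unique a F G n :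
    qkarray a F -> qkarray a G -> (forall i, n <= i -> a i = 0) ->
    (forall l v, (exists i, l < a i /\ F i l = v) <-> (exists i, l < a i /\ G i l = v)) ->
  forall l i, l < a i -> F i l = G i l.
Proof.
move=> VF VG an FG; elim=> [|l IH] i.
  exact: (qk_eq_col0 VF VG (FG 0)).
exact: (qk_eq_step VF VG an IH (FG l.+1)).
Qed.

(* If the columns are nested then a first entry leaving its row would be
   repeated in its column or caught by a type B triple. *)
Lemma qk_nested_const a F :
    qkarray a F ->
    (forall l i, l.+1 < a i -> exists r, l < a r /\ F r l = F i l.+1) ->
  forall l i, l < a i -> F i l = F i 0.
Proof.
move=> V nest; elim=> [//|l IH] i.
elim/ltn_ind: i => i IHi ai.
have [r [ar e]] := nest l i ai.
rewrite -(IH i (ltnW ai)).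
case: (ltngtP r i) => ri; last by rewrite -e ri.
- case: (ltnP l.+1 (a r)) => c.
    by have := qk_neq V ri c ai; rewrite (IHi r ri c) -e -(IH r ar).
  have := qk_B V ri ai ar (leq_ltn_trans c ai); rewrite e.
  by have := qk_row V ai; move=> ->; rewrite leqnn => /(_ (conj isT isT)).
- have := qk_row V ai.
  have := qk_col0 V ri (leq_ltn_trans (leq0n _) ai) (leq_ltn_trans (leq0n _) ar).
  by rewrite -(IH i (ltnW ai)) -(IH r ar); lia.
Qed.

(** A discrete intermediate value argument: climbing by at most one per row from at most [L] to
    above [L] must pass through [L]. *)
Lemma last_small_part (a : nat -> nat) v i L :
    (forall r, v <= r -> r < i -> a r.+1 <= (a r).+1) ->
  v < i -> a v <= L -> L < a i -> exists r, [/\ v <= r, r < i & a r = L].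
Proof.
elim: i => [//|i IH] up vi av ai; have := up i; rewrite ltnS in vi.
case: (leqP (a i) L) => c; first by move/(_ vi (ltnSn i)); exists i; split; lia.
move=> _; have [||r [? ? ?]] := IH _ _ av c; last by exists r; split; lia.
- by move=> r vr ri; apply: up; lia.
- by case: (ltngtP v i) vi av c => // ->; lia.
Qed.

(** With no empty row the first column is forced. If row [i] later drops to [v < i], then either [v]
    already stands in row [v] of that column, or some row [r] with [v <= r < i] ends just before it,
    and the last entry [r] of that row violates a type B condition. *)
Lemma qk_small_steps a F n :
    qkarray a F -> (forall i, n <= i -> a i = 0) ->
    (forall i, i < n -> 0 < a i) -> (forall i, i.+1 < n -> a i.+1 <= (a i).+1) ->
  forall l i, l < a i -> F i l = i.
Proof.
move=> V an pos up.
have lt_n i l : l < a i -> i < n by case: (ltnP i n) => // /an->.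
elim=> [|l IH]; elim/ltn_ind=> i IHi ai; have le_i := qk_le V ai.
  case: i => [|i] in IHi ai le_i *; first lia.
  have ai' := pos i (ltnW (lt_n _ _ ai)).
  by have := qk_col0 V (ltnSn i) ai' ai; rewrite IHi //; lia.
case: (ltngtP (F i l.+1) i) => // [c|]; last lia.
case: (ltnP l.+1 (a (F i l.+1))) => av.
  by have /(_ (IHi _ c av)) := qk_neq V c av ai.
have [r1 h1 h2|r [vr ri ar]] := last_small_part _ c av ai.
  by apply: up; have := lt_n _ _ ai; lia.
have alr : l < a r by rewrite ar.
case: (qk_B V ri ai alr); first by rewrite ar.
by rewrite IH // IH ?(ltnW ai) // (ltnW ri).
Qed.

(** * Boxes, contents and coefficients *)

Lemma card_le_rel (A B : finType) (S : {set A}) (S' : {set B}) (P : A -> B -> Prop) :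
    (forall x, x \in S -> exists2 y, y \in S' & P x y) ->
    (forall x x' y, x \in S -> x' \in S -> P x y -> P x' y -> x = x') ->
  #|S| <= #|S'|.
Proof.
move=> ex inj.
(* Choosing in [option B] provides a value also outside [S], where [B] may offer none. *)
have /fin_all_exists[g gP] x : exists y : option B,
    x \in S -> exists z, [/\ y = Some z, z \in S' & P x z].
  case: (boolP (x \in S)) => [/ex[z zS Pz]|_]; last by exists None.
  by exists (Some z) => _; exists z.
rewrite -(card_in_imset (f := g)) => [|x x' xS xS'].
  rewrite -(card_imset (mem S') (@Some_inj _)); apply: subset_leq_card.
  apply/subsetP => _ /imsetP[x xS ->]; have [z [-> zS _]] := gP x xS.
  exact: imset_f.
have [z [-> _ Pz]] := gP x xS; have [z' [-> _ Pz']] := gP x' xS' => -[e].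
by subst z'; apply: inj Pz Pz'.
Qed.

Section Boxes.

Variables (n : nat) (a : n.-tuple nat).

Local Notation len := (nth 0 a).

Lemma len_row (x : box a) : len (row x) = tnth a (row x).
Proof. by rewrite (tnth_nth 0). Qed.

Lemma col_lt (x : box a) : col x < len (row x).
Proof. by rewrite len_row /col ltn_ord. Qed.

Lemma len_ge i : n <= i -> len i = 0.
Proof. by move=> ni; rewrite nth_default ?size_tuple. Qed.

Lemma box_inj (x y : box a) : row x = row y :> nat -> col x = col y -> x = y.
Proof.
case: x => i p; case: y => i' p'; rewrite /row /col /= => /val_inj e.
by subst i' => /val_inj->.
Qed.

Lemma box_exists i l : l < len i -> exists x : box a, row x = i :> nat /\ col x = l.
Proof.
case: (ltnP i n) => [i_n|/len_ge->//] li.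
have li' : l < tnth a (Ordinal i_n) by rewrite (tnth_nth 0).
by exists (existT _ (Ordinal i_n) (Ordinal li')).
Qed.

Definition array_of (T : filling a) (i l : nat) : nat :=
  if [pick x : box a | (row x == i :> nat) && (col x == l)] is Some x then T x else 0.

Lemma array_ofE (T : filling a) (x : box a) : array_of T (row x) (col x) = T x.
Proof.
rewrite /array_of; case: pickP => [y /andP[/eqP r /eqP c]|/(_ x)].
  by rewrite (box_inj r c).
by rewrite !eqxx.
Qed.

(** The default [row x] never matters for a [qkarray], whose entries are bounded by their rows. *)
Definition filling_of (F : nat -> nat -> nat) : filling a :=
  [ffun x => insubd (row x) (F (row x) (col x))].

Lemma filling_ofE (F : nat -> nat -> nat) (x : box a) : F (row x) (col x) <= row x ->
  filling_of F x = F (row x) (col x) :> nat.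
Proof. by move=> le; rewrite ffunE val_insubd (leq_ltn_trans le (ltn_ord _)). Qed.

Lemma quasikey_fillingP T : reflect (qkarray len (array_of T)) (quasikey_filling T).
Proof.
apply: (iffP idP).
- case/and5P=> /forallP V1 /forallP V2 /forallP V3 /forallP V4 /forallP V5; split.
  + move=> i l h; have [x [rx cx]] := box_exists h.
    have [y [ry cy]] := box_exists (ltnW h).
    have /forallP/(_ x) := V1 y.
    by rewrite -val_eqE /= rx ry eqxx cx cy leqnSn -!array_ofE rx ry cx cy.
  + move=> i l h; have [x [rx cx]] := box_exists h.
    by have := V2 x; rewrite -array_ofE rx cx.
  + move=> i r h h1 h2; have [x [rx cx]] := box_exists h1.
    have [y [ry cy]] := box_exists h2.
    have /forallP/(_ y) := V3 x.
    by rewrite -!array_ofE rx ry cx cy h eqxx.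
  + move=> i r l h h1 h2; have [x [rx cx]] := box_exists h1.
    have [y [ry cy]] := box_exists h2.
    have /forallP/(_ y) := V4 x; rewrite -val_eqE /= -!array_ofE rx ry cx cy eqxx andbT.
    have -> /= : x != y by apply: contraTneq h => xy; rewrite -rx -ry xy ltnn.
    by move/eqP.
  + move=> i r l h h1 h2 h3; have [x [rx cx]] := box_exists h1.
    have [y [ry cy]] := box_exists h2; have [z [rz cz]] := box_exists (ltnW h1).
    have /forallP/(_ x)/forallP/(_ y) := V5 z.
    rewrite /typeA /adjacent /inversion_triple -!array_ofE -!len_row -val_eqE /=.
    by rewrite rx ry rz cx cy cz !eqxx h h3 /= => /negP N [N1 N2]; apply: N; rewrite N1 N2.
  + move=> i r l h h1 h2 h3; have [x [rx cx]] := box_exists h1.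
    have [y [ry cy]] := box_exists h2; have [z [rz cz]] := box_exists (ltnW h1).
    have /forallP/(_ x)/forallP/(_ y) := V5 z.
    rewrite /typeB /adjacent /inversion_triple -!array_ofE -!len_row -val_eqE /=.
    rewrite rx ry rz cx cy cz !eqxx h h3 /= orbT /= => /negP N [N1 N2].
    by apply: N; rewrite N1 N2.
- move=> V; apply/and5P; split; apply/forallP => x.
  + apply/forallP => y; apply/implyP => /andP[/eqP e c]; rewrite -!array_ofE -e.
    by apply: (qk_row_le V c); rewrite e col_lt.
  + by rewrite -array_ofE (qk_le V) ?col_lt.
  + apply/forallP => y; apply/implyP => /and3P[/eqP cx /eqP cy h].
    rewrite -!array_ofE cx cy; apply: (qk_col0 V h).
      exact: (leq_ltn_trans _ (col_lt x)).
    exact: (leq_ltn_trans _ (col_lt y)).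
  + apply/forallP => y; apply/implyP => /andP[xy /eqP c]; apply: contraNneq xy => e.
    apply/eqP/box_inj => //; apply: (@qk_inj _ _ _ _ (col x) V); rewrite ?col_lt //.
      by rewrite c col_lt.
    by rewrite array_ofE c array_ofE e.
  + move: x => z; apply/forallP => x; apply/forallP => y; apply/implyP.
    rewrite /inversion_triple => /orP[] /and4P[/andP[/eqP r /eqP c] /eqP c' h];
      rewrite -!len_row => hl; apply/negP => /andP[N1 N2].
    * have hx : (col z).+1 < len (row x) by rewrite -c col_lt.
      have hy : (col z).+1 < len (row y) by rewrite -c -c' col_lt.
      apply: (qk_A V h hx hy hl).
      by rewrite -c -{1 3}c' {1}r !array_ofE.
    * have hx : (col z).+1 < len (row z) by rewrite -c -r col_lt.
      have hy : col z < len (row y) by rewrite -c' col_lt.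
      apply: (qk_B V h hx hy hl).
      by rewrite -c -{1 3}c' -{2}r !array_ofE.
Qed.

Lemma array_of_filling_of F i l :
  qkarray len F -> l < len i -> F i l = array_of (filling_of F) i l.
Proof.
move=> V h; have [x [<- <-]] := box_exists h.
by rewrite array_ofE filling_ofE // (qk_le V) ?col_lt.
Qed.

Lemma filling_of_quasikey F : qkarray len F -> quasikey_filling (filling_of F).
Proof.
by move=> V; apply/quasikey_fillingP/(qkarray_ext _ V) => i l; apply: array_of_filling_of.
Qed.

Definition content (T : filling a) : 'X_{1..n} :=
  [multinom #|[set x | T x == v]| | v < n].

Lemma quasikeyE : quasikey a = (\sum_(T : filling a | quasikey_filling T) 'X_[content T])%R.
Proof.
apply: eq_bigr => T _; rewrite mprodXE; congr (mpolyX _ _).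
apply/mnmP => v; rewrite mnm_sumE mnmE -sum1_card big_mkcond [RHS]big_mkcond /=.
by apply: eq_bigr => x _; rewrite mnm1E inE; case: eqP.
Qed.

Lemma mcoeff_quasikey m :
  ((quasikey a)@_m)%R = Posz #|[set T : filling a | quasikey_filling T && (content T == m)]|.
Proof.
rewrite quasikeyE raddf_sum /= -natz -sum1_card natr_sum.
rewrite (eq_bigl _ _ (fun T => in_set _ T)) [RHS]big_mkcondr /=.
by apply: eq_bigr => T _; rewrite mcoeffX; case: eqP.
Qed.

Lemma card_content (T : filling a) (P : pred nat) :
  #|[set x | P (T x)]| = \sum_(v < n | P v) content T v.
Proof.
rewrite -sum1_card (partition_big T (fun v : 'I_n => P v)) => [|x]; last by rewrite inE.
apply: eq_bigr => v Pv; rewrite mnmE -sum1_card; apply: eq_bigl => x.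
by rewrite !inE andbC; case: eqP => // ->.
Qed.

End Boxes.

(** * Reversal of contents and comparison of coefficients *)

Definition revm n (m : 'X_{1..n}) : 'X_{1..n} := [multinom m (rev_ord v) | v < n].

Lemma revmE n (m : 'X_{1..n}) v : revm m v = m (rev_ord v).
Proof. by rewrite mnmE. Qed.

Lemma revmK n : involutive (@revm n).
Proof. by move=> m; apply/mnmP => v; rewrite !mnmE rev_ordK. Qed.

Lemma young_quasikeyE n (a : n.-tuple nat) :
  young_quasikey a =
  (\sum_(T : filling [tuple of rev a] | quasikey_filling T) 'X_[revm (content T)])%R.
Proof.
rewrite /young_quasikey quasikeyE rmorph_sum /=; apply: eq_bigr => T _.
rewrite comp_mpolyX [RHS]mpolyXE_id [RHS](reindex_inj rev_ord_inj) /=.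
by apply: eq_bigr => v _; rewrite tnth_mktuple revmE rev_ordK.
Qed.

Lemma mcoeff_young_quasikey n (a : n.-tuple nat) m :
  ((young_quasikey a)@_m)%R = ((quasikey [tuple of rev a])@_(revm m))%R.
Proof.
rewrite young_quasikeyE quasikeyE !raddf_sum /=; apply: eq_bigr => T _.
by rewrite !mcoeffX (can2_eq (@revmK n) (@revmK n)).
Qed.

Lemma quasikey_eq_youngP n (b c : n.-tuple nat) :
  quasikey b = young_quasikey c <->
  (forall m, ((quasikey b)@_m)%R = ((quasikey [tuple of rev c])@_(revm m))%R).
Proof.
split=> [-> m|e]; first by rewrite mcoeff_young_quasikey.
by apply/mpolyP => m; rewrite mcoeff_young_quasikey.
Qed.

(** This is all that the necessity argument uses of the equality of polynomials: every content of a
    filling of [b] occurs reversed for [e]. Contents are compared through arbitrary predicates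
    because both single values and ranges of values are counted later. *)
Definition reversible n (b e : n.-tuple nat) : Prop :=
  forall F, qkarray (nth 0 b) F -> exists2 G, qkarray (nth 0 e) G &
  forall P : pred nat, #|[set x : box b | P (F (row x) (col x))]|
    = #|[set y : box e | P (n - (G (row y) (col y)).+1)]|.

Lemma mcoeff_reversible n (b e : n.-tuple nat) :
  (forall m, ((quasikey b)@_m)%R = ((quasikey e)@_(revm m))%R) -> reversible b e.
Proof.
move=> be F V; have := be (content (filling_of b F)); rewrite !mcoeff_quasikey => -[eS].
have /card_gt0P[T] : 0 < #|[set T : filling e | quasikey_filling T
    && (content T == revm (content (filling_of b F)))]|.
  rewrite -eS; apply/card_gt0P; exists (filling_of b F).
  by rewrite inE eqxx filling_of_quasikey.
rewrite inE => /andP[/quasikey_fillingP VT /eqP cT].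
exists (array_of T) => // P.
have -> : [set x : box b | P (F (row x) (col x))] = [set x | P (filling_of b F x)].
  by apply/setP => x; rewrite !inE filling_ofE // (qk_le V) // col_lt.
have -> : [set y : box e | P (n - (array_of T (row y) (col y)).+1)]
        = [set y | P (n - (T y).+1)].
  by apply/setP => y; rewrite !inE array_ofE.
rewrite card_content (card_content _ (fun v => P (n - v.+1))) (reindex_inj rev_ord_inj) /=.
by apply: eq_big => // v _; rewrite cT revmE.
Qed.

(* [G] is obtained from [F] by moving each row of boxes to a row of the same
   length, reading it backwards and replacing each entry [v] by [n - v.+1];
   the row may depend on the box. *)
Definition rev_into n (a a' : nat -> nat) (F G : nat -> nat -> nat) : Prop :=
  forall i l, l < a i -> exists i', a' i' = a i /\ G i' (a i - l.+1) = n - (F i l).+1.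

(** Boxes go to mirrored columns of rows of the same length. The image recovers the row length and
    hence the column, and the value then recovers the row, since entries of a column are
    distinct. *)
Lemma card_content_rev_into n (b e : n.-tuple nat) (T : filling b) (T' : filling e) :
    quasikey_filling T ->
    rev_into n (nth 0 b) (nth 0 e) (array_of T) (array_of T') ->
  forall v, content T v <= content T' (rev_ord v).
Proof.
move=> /quasikey_fillingP V R v; rewrite !mnmE.
apply: (@card_le_rel _ _ _ _ (fun x y =>
  tnth e (row y) = tnth b (row x) /\ col y = tnth b (row x) - (col x).+1)).
  move=> x; rewrite inE => /eqP tx; have [i' [li ei]] := R _ _ (col_lt x).
  have [|y [ry cy]] := @box_exists n e i' (nth 0 b (row x) - (col x).+1).
    by rewrite li; have := col_lt x; lia.
  exists y; last by rewrite -!len_row ry li cy.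
  by rewrite inE; apply/eqP/val_inj; rewrite /= -array_ofE ry cy ei array_ofE tx.
move=> x x' y; rewrite !inE => /eqP tx /eqP tx' [ly cy] [ly' cy'].
have cl := col_lt x; have cl' := col_lt x'; rewrite !len_row in cl cl'.
have cxx : col x = col x' by lia.
apply: box_inj => //; apply: (@qk_inj _ _ _ _ (col x) V); rewrite ?col_lt //.
  by rewrite cxx col_lt.
by rewrite array_ofE cxx array_ofE tx tx'.
Qed.

Lemma content_rev_into n (b e : n.-tuple nat) (T : filling b) (T' : filling e) :
    quasikey_filling T -> quasikey_filling T' ->
    rev_into n (nth 0 b) (nth 0 e) (array_of T) (array_of T') ->
    rev_into n (nth 0 e) (nth 0 b) (array_of T') (array_of T) ->
  content T' = revm (content T).
Proof.
move=> VT VT' R R'; apply/mnmP => v; rewrite revmE; apply/eqP.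
by rewrite eqn_leq (card_content_rev_into VT' R') -{2}(rev_ordK v)
  (card_content_rev_into VT R).
Qed.

(** Passing from [F] to [G] and back to [F'] preserves both column and value, so the column sets
    agree and [qk_unique] applies. *)
Lemma rev_into_inj n (b e : n.-tuple nat) F F' G :
    qkarray (nth 0 b) F -> qkarray (nth 0 b) F' ->
    rev_into n (nth 0 b) (nth 0 e) F G -> rev_into n (nth 0 e) (nth 0 b) G F ->
    rev_into n (nth 0 b) (nth 0 e) F' G -> rev_into n (nth 0 e) (nth 0 b) G F' ->
  forall l i, l < nth 0 b i -> F i l = F' i l.
Proof.
have half F1 F2 : qkarray (nth 0 b) F1 -> qkarray (nth 0 b) F2 ->
    rev_into n (nth 0 b) (nth 0 e) F1 G -> rev_into n (nth 0 e) (nth 0 b) G F2 ->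
  forall l v, (exists i, l < nth 0 b i /\ F1 i l = v) ->
    (exists i, l < nth 0 b i /\ F2 i l = v).
  move=> V1 V2 R1 R2 l v [i [li <-]].
  have [i' [li' ei']] := R1 i l li.
  have [|i2 [li2 ei2]] := R2 i' (nth 0 b i - l.+1); first by lia.
  have bl : nth 0 e i' - (nth 0 b i - l.+1).+1 = l by lia.
  rewrite bl ei' in ei2; exists i2; rewrite li2 li'; split=> //.
  have F2i : F2 i2 l <= n.-1 by rewrite ei2; lia.
  have := qk_le V1 li; case: (ltnP i n) => [|/(len_ge b)]; lia.
move=> V V' R1 R2 R1' R2'; apply: (qk_unique V V' (@len_ge n b)).
by move=> l v; split; apply: half.
Qed.

Lemma card_le_rev_into n (b e : n.-tuple nat) :
    (forall F, qkarray (nth 0 b) F -> exists G, [/\ qkarray (nth 0 e) G,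
       rev_into n (nth 0 b) (nth 0 e) F G & rev_into n (nth 0 e) (nth 0 b) G F]) ->
  forall m, #|[set T : filling b | quasikey_filling T && (content T == m)]|
    <= #|[set T : filling e | quasikey_filling T && (content T == revm m)]|.
Proof.
move=> ex m; apply: (@card_le_rel _ _ _ _ (fun T T' => 
  rev_into n (nth 0 b) (nth 0 e) (array_of T) (array_of T') /\
  rev_into n (nth 0 e) (nth 0 b) (array_of T') (array_of T))).
- move=> T; rewrite inE => /andP[qT /eqP cT].
  have /quasikey_fillingP V := qT; have [G [VG R R']] := ex _ V.
  have RG := array_of_filling_of VG.
  have R1 : rev_into n (nth 0 b) (nth 0 e) (array_of T) (array_of (filling_of e G)).
    by move=> i l /[dup] li /R[i' [li' ei']]; exists i'; rewrite -RG //; lia.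
  have R2 : rev_into n (nth 0 e) (nth 0 b) (array_of (filling_of e G)) (array_of T).
    by move=> i l /[dup] li /R'[i' [li' ei']]; exists i'; rewrite -RG.
  exists (filling_of e G) => //; rewrite inE filling_of_quasikey //=.
  by rewrite (content_rev_into qT (filling_of_quasikey VG) R1 R2) cT.
- move=> T T' T1; rewrite !inE => /andP[/quasikey_fillingP V _].
  move=> /andP[/quasikey_fillingP V' _] [R1 R2] [R1' R2'].
  apply/ffunP => x; apply/val_inj; rewrite /= -!array_ofE.
  by apply: (rev_into_inj V V' R1 R2 R1' R2'); rewrite col_lt.
Qed.

Lemma quasikey_eq_young n (b c : n.-tuple nat) :
    let e := [tuple of rev c] in
    (forall F, qkarray (nth 0 b) F -> exists G, [/\ qkarray (nth 0 e) G,
       rev_into n (nth 0 b) (nth 0 e) F G & rev_into n (nth 0 e) (nth 0 b) G F]) ->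
    (forall F, qkarray (nth 0 e) F -> exists G, [/\ qkarray (nth 0 b) G,
       rev_into n (nth 0 e) (nth 0 b) F G & rev_into n (nth 0 b) (nth 0 e) G F]) ->
  quasikey b = young_quasikey c.
Proof.
move=> e be eb; apply/quasikey_eq_youngP => m; rewrite !mcoeff_quasikey; congr Posz.
apply/eqP; rewrite eqn_leq card_le_rev_into //=.
by rewrite -{2}(revmK m) card_le_rev_into.
Qed.

(** * Reversal of rectangles *)

Definition permutes k (s : nat -> nat) : Prop :=
  (forall i, i < k -> s i < k) /\
  (forall i l, i < k -> l < k -> s i = s l -> i = l).

Lemma permutes_surj k s y : permutes k s -> y < k -> exists2 x, x < k & s x = y.
Proof.
move=> [lt inj] yk; case: (boolP (y \in map s (iota 0 k))) => [/mapP[x]|ny].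
  by rewrite mem_iota => xk ->; exists x.
have : size (y :: map s (iota 0 k)) <= size (iota 0 k).
  apply: uniq_leq_size => [|_ /predU1P[->|/mapP[i + ->]]].
  - rewrite /= ny map_inj_in_uniq ?iota_uniq // => i l; rewrite !mem_iota; exact: inj.
  - by rewrite mem_iota.
  - by rewrite !mem_iota; apply: lt.
by rewrite /= size_map ltnn.
Qed.

Lemma sorting_permutation k (f : nat -> nat) :
    (forall i l, i < k -> l < k -> f i = f l -> i = l) ->
  exists2 s, permutes k s & forall i l, i < l -> l < k -> f (s i) < f (s l).
Proof.
move=> finj; pose sl := sort (relpre f leq) (iota 0 k).
have size_sl : size sl = k by rewrite size_sort size_iota.
have uniq_sl : uniq sl by rewrite sort_uniq iota_uniq.
have slk i : i < k -> nth 0 sl i < k.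
  move=> ik; have : nth 0 sl i \in sl by rewrite mem_nth ?size_sl.
  by rewrite mem_sort mem_iota.
have slinj i l : i < k -> l < k -> nth 0 sl i = nth 0 sl l -> i = l.
  by move=> ik lk /eqP; rewrite nth_uniq ?size_sl // => /eqP.
exists (nth 0 sl); first by [].
move=> i l il lk; have ik := ltn_trans il lk.
have : f (nth 0 sl i) <= f (nth 0 sl l).
  apply: (sorted_ltn_nth (leT := relpre f leq)); rewrite ?inE ?size_sl //.
    by move=> x y z; apply: leq_trans.
  by apply: sort_sorted => x y; apply: leq_total.
rewrite leq_eqVlt => /orP[/eqP|//] /(finj _ _ (slk _ ik) (slk _ lk)) /(slinj _ _ ik lk).
by move=> e; rewrite e ltnn in il.
Qed.

(** If the inequality failed at [i], the positions of the [i.+1] smallest values of [c] would all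
    lie among those of the [i] smallest values of [d]. *)
Lemma sorted_dominance k (c d s t : nat -> nat) :
    permutes k s -> permutes k t ->
    (forall i l, i < l -> l < k -> c (s i) < c (s l)) ->
    (forall i l, i < l -> l < k -> d (t i) < d (t l)) ->
    (forall i, i < k -> d i <= c i) ->
  forall i, i < k -> d (t i) <= c (s i).
Proof.
move=> ps pt cs dt dc i ik; rewrite leqNgt; apply/negP => lt.
have [ps1 ps2] := ps.
have /fin_all_exists[x xP] (l : 'I_i.+1) : exists x : 'I_i, t x = s l.
  have li := ltn_ord l; have lk : l < k by lia.
  have [x xk e] := permutes_surj pt (ps1 _ lk).
  suff xi : x < i by exists (Ordinal xi).
  rewrite ltnNge; apply/negP => ix.
  have h1 : d (t i) <= d (t x).
    by move: ix; rewrite leq_eqVlt => /orP[/eqP->//|/dt/(_ xk)/ltnW].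
  have h2 : c (s l) <= c (s i).
    by move: li; rewrite ltnS leq_eqVlt => /orP[/eqP->//|/cs/(_ ik)/ltnW].
  by have := dc _ (ps1 _ lk); rewrite -e; rewrite -e in h2; lia.
suff : i.+1 <= i by rewrite ltnn.
apply: (@inj_leq _ _ x) => l l' e; apply/val_inj/ps2; rewrite /= -?xP ?e //.
  by have := ltn_ord l; lia.
by have := ltn_ord l'; lia.
Qed.

(* Among the admissible rearrangements take one maximizing [sum (k - i) w (t i)]:
   exchanging the two entries of a type A violation would increase the sum. *)
Lemma next_column k (c w s : nat -> nat) :
    permutes k s -> (forall i l, i < k -> l < k -> w i = w l -> i = l) ->
    (forall i, i < k -> w (s i) <= c i) ->
  exists t, [/\ permutes k t, forall i, i < k -> w (t i) <= c i &
    forall i r, i < r -> r < k -> ~ (w (t r) <= c i /\ w (t i) <= w (t r))].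
Proof.
move=> [sk sinj] winj wc.
have s_inj : injective (fun i : 'I_k => Ordinal (sk _ (ltn_ord i))).
  by move=> i l [] /sinj e; apply/val_inj/e.
pose P (t : {perm 'I_k}) := [forall i : 'I_k, w (t i) <= c i].
pose Phi (t : {perm 'I_k}) := \sum_(i < k) (k - i) * w (t i).
have P0 : P (perm s_inj) by apply/forallP => i; rewrite permE /= wc.
case: (arg_maxnP Phi P0) => t /forallP Pt tmax.
pose t' i := if insub i is Some i' then t i' : nat else 0.
have t'E (i : 'I_k) : t' i = t i by rewrite /t' valK.
exists t'; split.
- split=> [i ik|i l ik lk]; first by rewrite -[i]/(val (Ordinal ik)) t'E.
  rewrite -[i]/(val (Ordinal ik)) -[l]/(val (Ordinal lk)) !t'E.
  by move=> /val_inj /perm_inj ->.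
- by move=> i ik; rewrite -[i]/(val (Ordinal ik)) t'E.
move=> i0 r0 ir rk [le1 le2].
pose i : 'I_k := Ordinal (ltn_trans ir rk); pose r : 'I_k := Ordinal rk.
rewrite -[i0]/(val i) -[r0]/(val r) !t'E in le1 le2; have ir' : i < r by [].
have ri : r != i by rewrite -val_eqE neq_ltn ir' orbT.
have lt : w (t i) < w (t r).
  rewrite ltn_neqAle le2 andbT; apply: contraNneq ri => /winj.
  by move=> /(_ (ltn_ord _) (ltn_ord _)) /val_inj /perm_inj ->.
have PhiE t1 : Phi t1 = (k - i) * w (t1 i) + ((k - r) * w (t1 r)
    + \sum_(x < k | (x != i) && (x != r)) (k - x) * w (t1 x)).
  by rewrite /Phi (bigD1 i) // (bigD1 r).
(* The exchange stays admissible: [le1] allows the larger entry at [i], and the smaller one fits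
   where the larger did. *)
have : P (tperm i r * t)%g.
  apply/forallP => x; rewrite permM; case: tpermP => [->//|->|_ _]; last exact: Pt.
  by apply: leq_trans (ltnW lt) (Pt r).
move/tmax => Phi_le; have {Phi_le} : Phi (tperm i r * t)%g <= Phi t by [].
rewrite !PhiE !permM tpermL tpermR.
rewrite [X in _ + (_ + X)](eq_bigr (fun x : 'I_k => (k - x) * w (t x))).
  by rewrite !addnA leq_add2r; have := ltn_ord i; have := ltn_ord r; nia.
by move=> x /andP[xi xr]; rewrite permM tpermD // eq_sym.
Qed.

(** The first column stays sorted, and [next_column] arranges each later column relative to the
    previous one. *)
Lemma arrange_columns k m (w : nat -> nat -> nat) :
    (forall l i r, l < m -> i < r -> r < k -> w l i < w l r) ->
    (forall l i, l.+1 < m -> i < k -> w l.+1 i <= w l i) ->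
  exists s : nat -> nat -> nat, [/\ forall i, s 0 i = i,
    forall l, permutes k (s l),
    forall l i, l.+1 < m -> i < k -> w l.+1 (s l.+1 i) <= w l (s l i) &
    forall l i r, l.+1 < m -> i < r -> r < k ->
     ~ (w l.+1 (s l.+1 r) <= w l (s l i) /\ w l.+1 (s l.+1 i) <= w l.+1 (s l.+1 r))].
Proof.
move=> winc wdec; elim: m winc wdec => [|m IH] winc wdec.
  by exists (fun _ i => i); split.
have [||s [s0 sp sle sA]] := IH.
- by move=> l i r lm; apply: winc; rewrite ltnS ltnW.
- by move=> l i lm; apply: wdec; rewrite ltnS ltnW.
case: m IH winc wdec sle sA => [|m] IH winc wdec sle sA; first by exists s; split.
have winj i l : i < k -> l < k -> w m.+1 i = w m.+1 l -> i = l.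
  move=> ik lk e; case: (ltngtP i l) => // h.
    by have := winc m.+1 _ _ (leqnn _) h lk; rewrite e ltnn.
  by have := winc m.+1 _ _ (leqnn _) h ik; rewrite e ltnn.
(* The arrangement of the previous column is an admissible start for the new one, since the sorted
   columns decrease entrywise. *)
have wc i : i < k -> w m.+1 (s m i) <= w m (s m i).
  by move=> ik; apply: wdec => //; apply: (sp m).1.
have [t [tp tle tA]] := next_column (sp m) winj wc.
exists (fun l => if l == m.+1 then t else s l); split=> //.
- by move=> l; case: eqP.
- move=> l i lm ik; rewrite eqSS; case: eqP lm => [-> _|ne lm].
    by rewrite (ltn_eqF (leqnn _)); apply: tle.
  by rewrite ltn_eqF; [apply: sle => //; lia | lia].
- move=> l i r lm ir rk; rewrite eqSS; case: eqP lm => [-> _|ne lm].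
    by rewrite (ltn_eqF (leqnn _)); apply: tA.
  by rewrite ltn_eqF; [apply: sA => //; lia | lia].
Qed.

(** Downward from [n - 1]: each value must leave room for the larger ones above it. *)
Lemma increasing_le j n (f : nat -> nat) :
    (forall i r, j <= i -> i < r -> r < n -> f i < f r) ->
    (forall i, j <= i -> i < n -> f i < n) ->
  forall i, j <= i -> i < n -> f i <= i.
Proof.
move=> inc lt i; have [d] := ubnP (n - i); elim: d i => // d IH i nid ji i_n.
case: (ltnP i.+1 n) => c; last by have := lt i ji i_n; lia.
by have := inc _ _ ji (ltnSn i) c; have := IH i.+1; lia.
Qed.

Lemma rev_rect j n m (a : nat -> nat) F :
    j <= n -> (forall i, a i = if (j <= i) && (i < n) then m else 0) ->
    qkarray a F ->
  exists G, [/\ qkarray a G, rev_into n a a F G & rev_into n a a G F].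
Proof.
move=> jn aE V; pose k := n - j; have kE : k = n - j by [].

have aj i : i < k -> a (j + i) = m by move=> ik; rewrite aE ifT; lia.
have a_m i l : l < a i -> [/\ j <= i, i < n, l < m & a i = m].
  by rewrite aE; case: ifP => // /andP[-> ->].
have /fin_all_exists[s0 s0P] (l : 'I_m) : exists s, permutes k s /\
    forall i r, i < r -> r < k -> F (j + s i) l < F (j + s r) l.
  have [|s sp si] := @sorting_permutation k (fun i => F (j + i) l); last by exists s.
  move=> i r ik rk e; suff : j + i = j + r by lia.
  by apply: (qk_inj V _ _ e); rewrite aj.
pose s l := if insub l is Some l' then s0 l' else id.
have sp l : l < m -> permutes k (s l) /\
    forall i r, i < r -> r < k -> F (j + s l i) l < F (j + s l r) l.
  by move=> lm; rewrite /s insubT /=; have := s0P (Ordinal lm).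
(* The columns of [F] sorted; by [sorted_dominance] the rows still weakly decrease. *)
pose u l i := F (j + s l i) l.
have u_n l i : l < m -> i < k -> u l i < n.
  move=> lm ik; have [[/(_ i ik) sk _] _] := sp l lm.
  by have := @qk_le _ _ V (j + s l i) l; rewrite aj // => /(_ lm); rewrite /u; lia.
have u_dec l i : l.+1 < m -> i < k -> u l.+1 i <= u l i.
  move=> lm ik; have [sp1 si1] := sp _ lm; have [sp2 si2] := sp _ (ltnW lm).
  apply: (sorted_dominance (c := fun i => F (j + i) l) (d := fun i => F (j + i) l.+1)
    sp2 sp1 si2 si1) => // r rk.
  by apply: (qk_row V); rewrite aj.
(* The rotation by 180 degrees of [u], with entries complemented. *)
pose w l i := n - (u (m - l.+1) (k - i.+1)).+1.
have w_inc l i r : l < m -> i < r -> r < k -> w l i < w l r.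
  move=> lm ir rk; have lm' : m - l.+1 < m by lia.
  have [_ si] := sp _ lm'; have ki : k - i.+1 < k by lia.
  have kri : k - r.+1 < k - i.+1 by lia.
  by have := si _ _ kri ki; have := u_n _ _ lm' ki; rewrite /w /u; lia.
have [||t [t0 tp tle tA]] := @arrange_columns k m w.
- exact: w_inc.
- move=> l i lm ik; rewrite /w; have -> : m - l.+1 = (m - l.+2).+1 by lia.
  have h1 : (m - l.+2).+1 < m by lia.
  have h2 : k - i.+1 < k by lia.
  by have := u_dec _ _ h1 h2; lia.
have tk l i : j <= i -> i < n -> t l (i - j) < k.
  by move=> ji i_n; apply: (tp l).1; rewrite /k; lia.
have w_inj l i r : l < m -> i < k -> r < k -> w l i = w l r -> i = r.
  move=> lm ik rk e; case: (ltngtP i r) => // h.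
    by have := w_inc l i r lm h rk; lia.
  by have := w_inc l r i lm h ik; lia.
pose G i l := w l (t l (i - j)).
have G_dec i l : l.+1 < a i -> G i l.+1 <= G i l.
  by case/a_m=> ji i_n lm ai; apply: tle => //; rewrite /k; lia.
have G0 i r : j <= i -> i < r -> r < n -> 0 < m -> G i 0 < G r 0.
  by move=> ji ir rn m0; rewrite /G !t0; apply: w_inc; rewrite // /k; lia.
(* Rows decrease, so the row bound only matters in the first column, which increases with values
   below [n]. *)
have G_le i l : l < a i -> G i l <= i.
  elim: l => [|l IH] h; last first.
    by apply: leq_trans (IH (ltnW h)); apply: G_dec.
  case/a_m: (h) => ji i_n m0 ai.
  apply: (@increasing_le j n (fun i => G i 0)) => // [r r' jr rr' rn|r jr rn].
    exact: G0.
  by rewrite /G /w; lia.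
exists G; split.
- split=> //.
  + by move=> i r ir /a_m[ji _ m0 _] /a_m[_ rn _ _]; apply: G0.
  + move=> i r l ir /a_m[ji i_n lm _] /a_m[jr rn _ _] /w_inj.
    move=> /(_ lm (tk _ _ ji i_n) (tk _ _ jr rn)) /(tp l).2.
    by rewrite /k; lia.
  + by move=> i r l ir /a_m[ji i_n lm _] /a_m[jr rn _ _] _; apply: tA; rewrite // /k; lia.
  + by move=> i r l ir /a_m[_ _ _ ->] /a_m[_ _ _ ->]; rewrite ltnn.
(* The box is traced through the three stages: [x] is its place in the sorted column, [k - x.+1] its
   place after rotation, [y] its place after rearrangement. *)
- move=> i l /[dup] li /a_m[ji i_n lm ai]; rewrite ai.
  have ik : i - j < k by rewrite /k; lia.
  have [x xk e] := permutes_surj (sp l lm).1 ik.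
  have xk' : k - x.+1 < k by lia.
  have [y yk e'] := permutes_surj (tp (m - l.+1)) xk'.
  exists (j + y); rewrite aj // /G addKn e' /w /u; split=> //.
  have -> : m - (m - l.+1).+1 = l by lia.
  have -> : k - (k - x.+1).+1 = x by lia.
  by rewrite e subnKC.
- move=> i l /[dup] li /a_m[ji i_n lm ai]; rewrite ai.
  set y := t l (i - j); have yk : y < k by apply: tk.
  have lm' : m - l.+1 < m by lia.
  have sk : s (m - l.+1) (k - y.+1) < k by apply: (sp _ lm').1.1; lia.
  exists (j + s (m - l.+1) (k - y.+1)); rewrite aj //; split=> //.
  have := u_n (m - l.+1) (k - y.+1) lm'; rewrite /G /w -/y /u; lia.
Qed.

(** * Sufficiency *)

(* The rows of [F] are pairwise noncrossing intervals [[last entry, first entry]]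
   listed by right endpoint; no row of length 1 lies inside an interval.  Hence
   listing them by left endpoint permutes only rows of length 2, and reversal
   turns left endpoints into right ones. *)
Lemma rev_ones_twos j n (a a' : nat -> nat) F :
    j <= n -> (forall i, j <= i -> i < n -> a i = 1 \/ a i = 2) ->
    (forall i, i < j \/ n <= i -> a i = 0 /\ a' i = 0) ->
    (forall i, j <= i -> i < n -> a' (n - (i - j).+1) = a i) ->
    qkarray a F ->
  exists G, [/\ qkarray a' G, rev_into n a a' F G & rev_into n a' a G F].
Proof.
move=> jn a12 a0 a'E V; pose k := n - j; have kE : k = n - j by [].
have in_n i l : l < a i -> j <= i /\ i < n.
  case: (ltnP i j) => c; first by have [-> _] := a0 i (or_introl c).
  by case: (ltnP i n) => d //; have [-> _] := a0 i (or_intror d).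
have in_n' i l : l < a' i -> j <= i /\ i < n.
  case: (ltnP i j) => c; first by have [_ ->] := a0 i (or_introl c).
  by case: (ltnP i n) => d //; have [_ ->] := a0 i (or_intror d).
have pos i : j <= i -> i < n -> 0 < a i by move=> ji i_n; case: (a12 i ji i_n) => ->.
(* The left endpoint of the interval of row [i]; the right endpoint is [F i 0]. *)
pose e i := F i (a i).-1.
have e_le i : j <= i -> i < n -> e i <= F i 0.
  by move=> ji i_n; apply: (qk_row_le V) => //; have := pos _ ji i_n; lia.
have c_inc i r : j <= i -> i < r -> r < n -> F i 0 < F r 0.
  by move=> ji ir rn; apply: (qk_col0 V) => //; apply: pos; lia.
have out i r : j <= i -> i < n -> j <= r -> r < n -> a i = 1 -> a r = 2 ->
    ~ (e r <= F i 0 /\ F i 0 <= F r 0).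
  move=> ji i_n jr rn ai ar [h1 h2]; case: (ltngtP i r) => ir.
  - apply: (qk_B V ir (l := 0)); rewrite ?ai ?ar //.
    by move: h1; rewrite /e ar.
  - by have := c_inc _ _ jr ir i_n; lia.
  - by move: ai; rewrite ir ar.
have e1 i : a i = 1 -> e i = F i 0 by rewrite /e => ->.
have e_inj i r : j <= i -> i < r -> r < n -> e i <> e r.
  move=> ji ir rn eir; have i_n := ltn_trans ir rn; have jr : j <= r by lia.
  have := c_inc _ _ ji ir rn; have := e_le _ ji i_n; have := e_le _ jr rn.
  case: (a12 _ ji i_n) => ai; case: (a12 _ jr rn) => ar.
  - by rewrite -(e1 _ ai) -(e1 _ ar); lia.
  - by have := out _ _ ji i_n jr rn ai ar; rewrite -(e1 _ ai); lia.
  - by rewrite -(e1 _ ar); lia.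
  - by have := qk_neq V (l := 1) ir; rewrite ai ar => /(_ isT isT); move: eir; rewrite /e ai ar.
have e_sing i r : j <= i -> i < n -> j <= r -> r < n -> a r = 1 ->
    (e i < e r) = (i < r).
  move=> ji i_n jr rn ar; rewrite (e1 _ ar); have := e_le _ ji i_n.
  case: (ltngtP i r) => ir.
  - by have := c_inc _ _ ji ir rn; lia.
  - have := c_inc _ _ jr ir i_n; case: (a12 _ ji i_n) => ai; first by rewrite (e1 _ ai); lia.
    by have := out _ _ jr rn ji i_n ar ai; lia.
  - by rewrite ir (e1 _ ar); lia.
have [|s sp si] := @sorting_permutation k (fun i => e (j + i)).
  move=> i r ik rk eir; case: (ltngtP i r) => // h.
  - by case: (@e_inj (j + i) (j + r)); lia.
  - by case: (@e_inj (j + r) (j + i)); lia.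
(* By [e_sing], the rows with left endpoint below a singleton are exactly the rows below it, so
   sorting by left endpoints leaves the singleton in place. *)
have s_fix p : p < k -> a (j + s p) = 1 -> s p = p.
  move=> pk ap; have spk := sp.1 _ pk.
  have lt q : q < k -> (q < p) = (s q < s p).
    move=> qk; have sqk := sp.1 _ qk.
    have := e_sing (j + s q) (j + s p); rewrite ltn_add2l => <- //; try lia.
    case: (ltngtP q p) => qp; last by rewrite qp ltnn.
    - by rewrite si.
    - by have := si _ _ qp qk; lia.
  apply/eqP; rewrite eqn_leq; apply/andP; split; last first.
    have ex (q : 'I_p) : exists x : 'I_(s p), x = s q :> nat.
      have := ltn_ord q; rewrite lt; last by have := ltn_ord q; lia.
      by move=> h; exists (Ordinal h).
    have [x xP] := fin_all_exists ex.
    apply: (@inj_leq _ _ x) => q q' e'; apply/val_inj/sp.2; rewrite /= -?xP ?e' //.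
      by have := ltn_ord q; lia.
    by have := ltn_ord q'; lia.
  have /fin_all_exists[x xP] (q : 'I_(s p)) : exists x : 'I_p, s x = q.
    have qk : q < k by have := ltn_ord q; lia.
    have [x xk e'] := permutes_surj sp qk.
    suff xp : x < p by exists (Ordinal xp).
    by rewrite lt // e'.
  by apply: (@inj_leq _ _ x) => q q' e'; apply/val_inj; rewrite /= -!xP e'.
have a_s p : p < k -> a (j + s p) = a (j + p).
  move=> pk; have spk := sp.1 _ pk.
  have [h|h] : a (j + s p) = 1 \/ a (j + s p) = 2 by apply: a12; lia.
    by rewrite s_fix.
  have [g|g] : a (j + p) = 1 \/ a (j + p) = 2 by apply: a12; lia.
    have [x xk ex] := permutes_surj sp pk.
    have xp : x = p by rewrite -[RHS]ex s_fix // ex.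
    by move: ex; rewrite xp => ->.
  by rewrite g h.
(* [R i] is the row of [F] that becomes row [i] of [G]; left endpoints decrease along [R], so their
   complements form an increasing first column. *)
pose R i := j + s (n - i.+1).
have Rn i : j <= i -> i < n -> j <= R i /\ R i < n.
  move=> ji i_n; have h : n - i.+1 < k by lia.
  by have := sp.1 _ h; rewrite /R; lia.
have aR i : j <= i -> i < n -> a (R i) = a' i.
  move=> ji i_n; rewrite /R a_s; last lia.
  have := a'E (j + (n - i.+1)); rewrite addKn.
  have -> : n - (n - i.+1).+1 = i by lia.
  by move=> -> //; lia.
have eR i r : j <= i -> i < r -> r < n -> e (R r) < e (R i).
  by move=> ji ir rn; apply: si; lia.
have R_inj i r : j <= i -> i < r -> r < n -> R i <> R r.
  by move=> ji ir rn E; have := eR _ _ ji ir rn; rewrite E ltnn.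
have F_lt i l : l < a i -> F i l < n.
  by move=> h; have := qk_le V h; have := in_n _ _ h; lia.
pose G i l := n - (F (R i) (a' i - l.+1)).+1.
have G0E i : j <= i -> i < n -> G i 0 = n - (e (R i)).+1.
  by move=> ji i_n; rewrite /G /e aR // subn1.
have G_0 i r : j <= i -> i < r -> r < n -> G i 0 < G r 0.
  move=> ji ir rn; have i_n := ltn_trans ir rn; have jr : j <= r by lia.
  rewrite !G0E //; have := eR _ _ ji ir rn.
  have [h1 h2] := Rn _ ji i_n.
  by have := F_lt (R i) (a (R i)).-1; rewrite -/(e _); have := pos _ h1 h2; lia.
have G_dec i l : l.+1 < a' i -> G i l.+1 <= G i l.
  move=> h; have [ji i_n] := in_n' _ _ h; rewrite /G.
  have -> : a' i - l.+1 = (a' i - l.+2).+1 by lia.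
  have := @qk_row _ _ V (R i) (a' i - l.+2); rewrite aR //; lia.
have G_le i l : l < a' i -> G i l <= i.
  elim: l => [|l IH] h; last by apply: leq_trans (IH (ltnW h)); apply: G_dec.
  have [ji i_n] := in_n' _ _ h.
  apply: (@increasing_le j n (fun i => G i 0)) => // r jr rn.
  by rewrite /G; lia.
have two i l : l.+1 < a' i -> [/\ j <= i, i < n, a' i = 2, a (R i) = 2 & l = 0].
  move=> h; have [ji i_n] := in_n' _ _ h; have [h1 h2] := Rn _ ji i_n.
  by have := a12 _ h1 h2; rewrite (aR _ ji i_n) => -[]; split=> //; lia.
exists G; split.
- split=> //.
  + by move=> i r ir /in_n'[ji _] /in_n'[_ rn]; apply: G_0.
  + move=> i r [|l] ir hi hr; have [ji i_n] := in_n' _ _ hi; have [jr rn] := in_n' _ _ hr.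
      by have := G_0 _ _ ji ir rn; lia.
    have [_ _ ai aRi l0] := two _ _ hi; have [_ _ ar aRr _] := two _ _ hr.
    rewrite /G ai ar l0 !subSS !subn0 => E; case: (R_inj i r) => //.
    apply: (qk_inj V (l := 0)); rewrite ?aRi ?aRr //.
    have := F_lt (R i) 0; have := F_lt (R r) 0; rewrite aRi aRr; lia.
  + move=> i r l ir hi hr _; have [ji i_n ai aRi l0] := two _ _ hi.
    have [jr rn ar aRr _] := two _ _ hr; rewrite l0 /G ai ar !subSS !subn0.
    have [h1 h2] := Rn _ ji i_n; have [h3 h4] := Rn _ jr rn.
    have lti : F (R i) 0 < n by apply: F_lt; rewrite aRi.
    have ltr : F (R r) 0 < n by apply: F_lt; rewrite aRr.
    (* A type A violation in [G] makes the intervals of [R r] and [R i] cross in [F]: this is a type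
       A violation there, or contradicts the increasing first column. *)
    have := eR _ _ ji ir rn; rewrite /e aRi aRr /= => er [N1 N2].
    have le1 : F (R i) 1 <= F (R i) 0 by apply: (qk_row V); rewrite aRi.
    case: (ltngtP (R r) (R i)) => c.
    * by apply: (qk_A V c (l := 0)); rewrite ?aRi ?aRr //; lia.
    * by have := c_inc _ _ h1 c h4; lia.
    * by case: (R_inj i r).
  + move=> i r l ir hr hi air; have [jr rn ar aRr l0] := two _ _ hr.
    have [ji i_n] := in_n' _ _ hi; have [h1 h2] := Rn _ ji i_n; have [h3 h4] := Rn _ jr rn.
    have ai : a' i = 1 by have := a12 _ h1 h2; rewrite aR // => -[|ai] //; lia.
    have aRi : a (R i) = 1 by rewrite aR.
    (* A type B violation in [G] puts a singleton inside an interval of [F], which [out] forbids. *)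
    have := out _ _ h1 h2 h3 h4 aRi aRr; rewrite /e aRr l0 /G ai ar !subSS !subn0 /=.
    have lti : F (R i) 0 < n by apply: F_lt; rewrite aRi.
    have ltr : F (R r) 0 < n by apply: F_lt; rewrite aRr.
    have le1 : F (R r) 1 <= F (R r) 0 by apply: (qk_row V); rewrite aRr.
    by move=> N [N1 N2]; apply: N; lia.
- move=> i l li; have [ji i_n] := in_n _ _ li.
  have ik : i - j < k by lia.
  have [x xk E] := permutes_surj sp ik.
  have RE : R (n - x.+1) = i.
    have xx : n - (n - x.+1).+1 = x by lia.
    by rewrite /R xx E; lia.
  have aE : a' (n - x.+1) = a i by rewrite -aR ?RE //; lia.
  exists (n - x.+1); rewrite aE; split=> //.
  rewrite /G aE RE; congr (n - (F i _).+1); lia.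
- move=> i l li; have [ji i_n] := in_n' _ _ li; exists (R i); rewrite aR //; split=> //.
  by have := F_lt (R i) (a' i - l.+1); rewrite aR // /G; lia.
Qed.

Lemma rev_const n (a a' : nat -> nat) F :
    (forall i, n <= i -> a i = 0 /\ a' i = 0) ->
    (forall i, i < n -> a' (n - i.+1) = a i) ->
    (forall l i, l < a i -> F i l = i) ->
  exists G, [/\ qkarray a' G, rev_into n a a' F G & rev_into n a' a G F].
Proof.
move=> a0 aa' FE; exists (fun i _ => i); split; first exact: qk_const.
- move=> i l li; exists (n - i.+1); rewrite FE //; split=> //; apply: aa'.
  by case: (ltnP i n) li => // /a0[->].
- move=> i l li.
  have i_n : i < n by case: (ltnP i n) li => // /a0[_ ->].
  have e : n - (n - i.+1).+1 = i by lia.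
  have aE : a (n - i.+1) = a' i by rewrite -aa' ?e //; lia.
  exists (n - i.+1); split=> //; apply: FE; rewrite aE; lia.
Qed.

Lemma nth_revK n (a : n.-tuple nat) i : i < n -> nth 0 (rev a) (n - i.+1) = nth 0 a i.
Proof.
move=> i_n; rewrite nth_rev size_tuple; last lia.
by congr nth; lia.
Qed.

(** Reversal preserves small steps, so on both sides only the constant filling exists. *)
Lemma small_steps_quasikey n (a : n.-tuple nat) :
  no_zero_small_steps a -> quasikey a = young_quasikey a.
Proof.
move=> [no0 /(sortedP 0) st].
have pos i : i < n -> 0 < nth 0 a i.
  move=> i_n; rewrite lt0n; apply: contraNneq no0 => <-.
  by rewrite mem_nth ?size_tuple.
have step i : i.+1 < n -> nth 0 a i.+1 <= (nth 0 a i).+1 /\ nth 0 a i <= (nth 0 a i.+1).+1.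
  by move=> i_n; have := st i; rewrite size_tuple => /(_ i_n) /andP[].
have la i : n <= i -> nth 0 a i = 0 by move=> h; rewrite len_ge.
have lr i : n <= i -> nth 0 (rev a) i = 0.
  by move=> h; rewrite (len_ge [tuple of rev a]).
have rE i : i < n -> nth 0 (rev a) i = nth 0 a (n - i.+1).
  by move=> i_n; rewrite nth_rev size_tuple.
apply: quasikey_eq_young => F V /=.
  apply: rev_const => [i ni|i i_n|l i li].
  - by split; [apply: la | apply: lr].
  - exact: nth_revK.
  - by apply: (qk_small_steps V la pos _ li) => r rn; have [] := step r rn.
apply: rev_const => [i ni|i i_n|l i li].
- by split; [apply: lr | apply: la].
- by rewrite rE.
- apply: (qk_small_steps V lr _ _ li) => [r rn|r rn]; rewrite !rE ?pos //; try lia.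
  have -> : n - r.+1 = (n - r.+2).+1 by lia.
  by have [] := step (n - r.+2); lia.
Qed.

Lemma equal_parts_quasikey n (a : n.-tuple nat) :
  equal_parts_then_zeros a -> exists b : n.-tuple nat, quasikey b = young_quasikey a.
Proof.
move=> [k [m [j E]]]; exists [tuple of rev a].
have sz : n = k + j by have := size_tuple a; rewrite E size_cat !size_nseq.
have rE i : nth 0 (rev a) i = if (j <= i) && (i < n) then m else 0.
  rewrite E rev_cat !rev_nseq nth_cat size_nseq !nth_nseq.
  case: ltnP => c /=; first by [].
  by have -> : (i - j < k) = (i < n) by lia.
have jn : j <= n by rewrite sz leq_addl.
apply: quasikey_eq_young => F V; exact: (rev_rect jn rE V).
Qed.

Lemma ones_twos_quasikey n (a : n.-tuple nat) :
  ones_twos_then_zeros a -> exists b : n.-tuple nat, quasikey b = young_quasikey a.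
Proof.
move=> [t [j [t12 E]]].
have sz : n = size t + j by have := size_tuple a; rewrite E size_cat !size_nseq.
(* The zeros move to the front and the other parts keep their order, whereas [rev a] lists them
   backwards after the zeros. *)
have sb : size (nseq j 0 ++ t) == n by rewrite size_cat size_nseq addnC sz.
exists (Tuple sb).
have rE : rev a = nseq j 0 ++ rev t :> seq nat by rewrite E rev_cat rev_nseq.
have t12' i : j <= i -> i < n -> nth 0 t (i - j) = 1 \/ nth 0 t (i - j) = 2.
  move=> ji i_n; have /(all_nthP 0)/(_ (i - j)) := t12.
  by case/(_ _)/orP; [lia | move/eqP; left | move/eqP; right].
have r_nth i : j <= i -> i < n -> nth 0 (rev t) (i - j) = nth 0 t (n - i.+1).
  move=> ji i_n; rewrite nth_rev; last lia.
  by congr nth; lia.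
have out i (u : seq nat) : size u = size t -> i < j \/ n <= i -> nth 0 (nseq j 0 ++ u) i = 0.
  move=> su h; rewrite nth_cat size_nseq nth_nseq; case: ltnP => c //.
  by rewrite nth_default // su; lia.
have inn i (u : seq nat) : j <= i -> nth 0 (nseq j 0 ++ u) i = nth 0 u (i - j).
  by move=> ji; rewrite nth_cat size_nseq ltnNge ji.
apply: quasikey_eq_young => F /=; rewrite rE => V.
  apply: (@rev_ones_twos j) V; first lia.
  - by move=> i ji i_n; rewrite inn //; apply: t12'.
  - by move=> i h; rewrite !out ?size_rev.
  - move=> i ji i_n; rewrite !inn ?r_nth //; try lia.
    by congr nth; lia.
apply: (@rev_ones_twos j) V; first lia.
- move=> i ji i_n; rewrite inn // r_nth //.
  have -> : n - i.+1 = (n - (i - j).+1) - j by lia.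
  by apply: t12'; lia.
- by move=> i h; rewrite !out ?size_rev.
- move=> i ji i_n; rewrite !inn ?r_nth //; try lia.
  by congr nth; lia.
Qed.

(** * Contents and extremal fillings *)

Lemma card_boxes n (a : n.-tuple nat) (P : nat -> nat -> bool) :
  #|[set x : box a | P (row x) (col x)]| = \sum_(i < n) \sum_(l < nth 0 a i) P i l.
Proof.
rewrite -sum1_card big_mkcond /=.
rewrite (eq_bigr (fun x : box a => P (row x) (col x) : nat)); last first.
  by move=> x _; rewrite inE; case: P.
rewrite -(sig_big_dep xpredT (fun _ _ => true)
  (fun (i : 'I_n) (l : 'I_(tnth a i)) => (P i l : nat))) /=.
by apply: eq_bigr => i _; rewrite (tnth_nth 0).
Qed.

Lemma card_rows n (a : n.-tuple nat) (P : pred nat) :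
  #|[set x : box a | P (row x)]| = \sum_(i < n | P i) nth 0 a i.
Proof.
rewrite (card_boxes a (fun i _ => P i)) [RHS]big_mkcond; apply: eq_bigr => i _.
by rewrite sum_nat_const card_ord mulnC; case: P; rewrite ?mul1n.
Qed.

Lemma card_row n (a : n.-tuple nat) i : #|[set x : box a | row x == i :> nat]| = nth 0 a i.
Proof.
rewrite (card_rows a (pred1 i)); case: (ltnP i n) => h; last first.
  by rewrite len_ge // big_pred0 // => r /=; rewrite ltn_eqF // (leq_trans _ h).
by rewrite (big_pred1 (Ordinal h)) // => r; rewrite /= -val_eqE.
Qed.

Lemma card_cols_lt n (a : n.-tuple nat) s :
  #|[set x : box a | col x < s]| = \sum_(i < n) minn (nth 0 a i) s.
Proof.
rewrite (card_boxes a (fun _ l => l < s)); apply: eq_bigr => i _.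
rewrite -(big_mkord xpredT (fun l => (l < s : nat))).
elim: (nth 0 a i) => [|m IH]; first by rewrite big_nil min0n.
by rewrite big_nat_recr //= IH; lia.
Qed.

Section Content.

Variables (n : nat) (a : n.-tuple nat) (F : nat -> nat -> nat).
Hypothesis V : qkarray (nth 0 a) F.

Local Notation val_at x := (F (row x) (col x)).

Lemma val_at_lt (x : box a) : val_at x < n.
Proof. by apply: leq_ltn_trans (qk_le V (col_lt x)) (ltn_ord _). Qed.

Lemma value_col_inj (x y : box a) : val_at x = val_at y -> col x = col y -> x = y.
Proof.
move=> e c; apply: box_inj => //; apply: (@qk_inj _ _ _ _ (col x) V).
- exact: col_lt.
- by rewrite c col_lt.
- by rewrite e c.
Qed.

Lemma card_value_cols (A : {set box a}) m v :
    (forall x, x \in A -> val_at x = v /\ col x < m) -> #|A| <= m.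
Proof.
move=> Av; rewrite -[m in _ <= m]card_ord -cardsT.
apply: (@card_le_rel _ _ _ _ (fun x (l : 'I_m) => col x = l)).
  by move=> x /Av[_ xm]; exists (Ordinal xm).
by move=> x y l /Av[ex _] /Av[ey _] cx cy; apply: value_col_inj; rewrite ?ex // cx.
Qed.

(** A value occurs at most once per column, so [m] occurrences within the first [m] columns meet all
    of them. *)
Lemma value_all_cols (A : {set box a}) m v c :
    (forall x, x \in A -> val_at x = v /\ col x < m) -> m <= #|A| -> c < m ->
  exists2 x, x \in A & col x = c.
Proof.
move=> Av mA cm; case: (boolP [exists x in A, col x == c]).
  by case/existsP=> x /andP[xA /eqP]; exists x.
move=> /existsPn no; have : #|A| <= #|[set~ Ordinal cm]|; last first.
  by rewrite cardsC1 card_ord; case: (m) cm mA => // m' _; lia.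
apply: (@card_le_rel _ _ _ _ (fun x (l : 'I_m) => col x = l)).
  move=> x /[dup] xA /Av[_ xm]; exists (Ordinal xm) => //.
  by rewrite !inE -val_eqE /=; have := no x; rewrite xA.
by move=> x y l /Av[ex _] /Av[ey _] cx cy; apply: value_col_inj; rewrite ?ex // cx.
Qed.

(* Each value occurs at most [s] times in the first [s] columns; the columns
   are nested as soon as this bound is attained throughout. *)
Local Notation early s v := ( #|[set x : box a | (val_at x == v) && (col x < s)]|).
Local Notation cont v := #|[set x : box a | val_at x == v]|.

Lemma early_le s v : early s v <= minn (cont v) s.
Proof.
rewrite leq_min; apply/andP; split.
  by apply: subset_leq_card; apply/subsetP => x; rewrite !inE => /andP[].
by apply: (@card_value_cols _ s v) => x; rewrite inE => /andP[/eqP].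
Qed.

Lemma sum_early s : \sum_(v < n) early s v = \sum_(i < n) minn (nth 0 a i) s.
Proof.
rewrite -card_cols_lt -[RHS]sum1_card.
rewrite (partition_big (fun x => Ordinal (val_at_lt x)) xpredT) //=.
apply: eq_bigr => v _; rewrite -sum1_card; apply: eq_bigl => x.
by rewrite !inE andbC -val_eqE.
Qed.

(** These are partial sums of conjugate partitions, so the inequality says that the sorted shape
    dominates the sorted content. *)
Lemma minn_content_ge s :
  \sum_(i < n) minn (nth 0 a i) s <= \sum_(v < n) minn (cont v) s.
Proof. by rewrite -sum_early; apply: leq_sum => v _; apply: early_le. Qed.

Lemma qk_extremal_const :
    (forall s, \sum_(v < n) minn (cont v) s <= \sum_(i < n) minn (nth 0 a i) s) ->
  forall l i, l < nth 0 a i -> F i l = F i 0.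
Proof.
(* Termwise inequalities whose sums are compared the other way are equalities. *)
move=> ge; have earlyE s v : v < n -> early s v = minn (cont v) s.
  move=> vn; have le := leqif_sum (fun (w : 'I_n) (_ : true) => leqif_eq (early_le s w)).
  have := le.2; rewrite eqn_leq le.1 sum_early ge /= => /esym/forallP/(_ (Ordinal vn)).
  by move/eqP.
apply: (qk_nested_const V) => l i li.
have [x [rx cx]] := box_exists li.
pose v := F i l.+1; have vx : val_at x = v by rewrite rx cx.
have vn : v < n by rewrite -vx val_at_lt.
case: (boolP [exists y : box a, (val_at y == v) && (col y == l)]).
  case/existsP=> y /andP[/eqP vy /eqP cy]; exists (row y).
  by rewrite -{1}cy col_lt -[F i _]vy cy.
(* If [v] skipped column [l], its early count would stall there and grow afterwards, which
   [minn (cont v) s] cannot do as [s] increases. *)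
move=> /existsPn no; have E1 : early l.+1 v = early l v.
  apply: eq_card => y; rewrite !inE ltnS leq_eqVlt.
  by have := no y; case: eqP => //= _ /negbTE->.
have lt : early l.+1 v < early l.+2 v.
  apply: proper_card; apply/properP; split.
    by apply/subsetP => y; rewrite !inE => /andP[-> /leqW].
  by exists x; rewrite !inE vx cx eqxx ?ltnSn // ltnn.
by move: E1 lt; rewrite !earlyE //; lia.
Qed.

End Content.

(** * Necessity: the shapes of the two compositions *)

Lemma reversible_const n (b e : n.-tuple nat) :
    reversible e b -> exists2 G, qkarray (nth 0 b) G &
    forall P : pred nat, #|[set x : box b | P (G (row x) (col x))]|
      = #|[set y : box e | P (n - (row y).+1)]|.
Proof.
move=> /(_ _ (qk_const _))[G VG GE]; exists G => // P.
rewrite (GE (fun v => P (n - v.+1))); apply: eq_card => x; rewrite !inE.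
by have := val_at_lt VG x; move=> h; congr P; lia.
Qed.

Lemma card_value_reversed n (b e : n.-tuple nat) (G : nat -> nat -> nat) v :
    (forall P : pred nat, #|[set x : box b | P (G (row x) (col x))]|
      = #|[set y : box e | P (n - (row y).+1)]|) ->
  v < n -> #|[set x : box b | G (row x) (col x) == v]| = nth 0 e (n - v.+1).
Proof.
move=> GE vn; rewrite (GE (pred1 v)) -card_row; apply: eq_card => y; rewrite !inE.
by have := ltn_ord (row y); lia.
Qed.

Lemma sum_minn_content n (b e : n.-tuple nat) (G : nat -> nat -> nat) s :
    (forall P : pred nat, #|[set x : box b | P (G (row x) (col x))]|
      = #|[set y : box e | P (n - (row y).+1)]|) ->
  \sum_(v < n) minn #|[set x : box b | G (row x) (col x) == v]| s
    = \sum_(i < n) minn (nth 0 e i) s.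
Proof.
move=> GE; rewrite (reindex_inj rev_ord_inj); apply: eq_bigr => v _.
rewrite (card_value_reversed GE) //; congr (minn (nth 0 e _) s) => /=.
by have := ltn_ord v; lia.
Qed.

(** Dominance holds in both directions, so the filling of [b] with the reversed content of the
    constant filling of [e] is extremal and has constant rows. [phi i] is the value of row [i];
    counting its occurrences gives the equality of row lengths. *)
Lemma reversible_embedding n (b e : n.-tuple nat) :
    reversible b e -> reversible e b ->
  exists phi : nat -> nat,
    (forall i, 0 < nth 0 b i -> phi i <= i /\ nth 0 e (n - (phi i).+1) = nth 0 b i) /\
    (forall i r, i < r -> 0 < nth 0 b i -> 0 < nth 0 b r -> phi i < phi r).
Proof.
move=> /reversible_const[G' VG' GE'] /reversible_const[G VG GE].
have const : forall l i, l < nth 0 b i -> G i l = G i 0.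
  apply: qk_extremal_const => // s; rewrite (sum_minn_content s GE).
  by rewrite -(sum_minn_content s GE'); apply: minn_content_ge.
exists (fun i => G i 0); split=> [i bi|i r]; last exact: (qk_col0 VG).
split; first exact: (qk_le VG).
have i_n : i < n by case: (ltnP i n) bi => // /(len_ge b)->.
rewrite -(card_value_reversed GE); last by apply: leq_ltn_trans (qk_le VG bi) i_n.
rewrite -card_row; apply: eq_card => x; rewrite !inE (const _ _ (col_lt x)).
apply/eqP/eqP => [|-> //]; apply: (qk_inj VG) => //.
exact: (leq_ltn_trans _ (col_lt x)).
Qed.

Definition nonzero_rows n (a : n.-tuple nat) : {set 'I_n} := [set i : 'I_n | 0 < nth 0 a i].

Lemma card_nonzero_rows_le n (b e : n.-tuple nat) :
  reversible b e -> reversible e b -> #|nonzero_rows b| <= #|nonzero_rows e|.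
Proof.
move=> be eb; have [phi [phiP phi_inc]] := reversible_embedding be eb.
apply: (@card_le_rel _ _ _ _ (fun i r : 'I_n => r = n - (phi i).+1 :> nat)) => [i|i i' r].
  rewrite inE => bi; have [le eE] := phiP _ bi.
  have lt : n - (phi i).+1 < n by have := ltn_ord i; lia.
  by exists (Ordinal lt); rewrite // inE /= eE.
rewrite !inE => bi bi' -> /= e'; apply/val_inj => /=.
have [le _] := phiP _ bi; have [le' _] := phiP _ bi'.
have := ltn_ord i; have := ltn_ord i'.
case: (ltngtP i i') => // h.
  by have := phi_inc _ _ h bi bi'; lia.
by have := phi_inc _ _ h bi' bi; lia.
Qed.

Definition rank n (a : n.-tuple nat) (i : nat) : nat :=
  #|[set r in nonzero_rows a | r < i]|.

Lemma rank_qkarray n (a : n.-tuple nat) : qkarray (nth 0 a) (fun i _ => rank a i).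
Proof.
have inc i r : i < r -> 0 < nth 0 a i -> rank a i < rank a r.
  move=> ir ai; have i_n : i < n by case: (ltnP i n) ai => // /(len_ge a)->.
  apply: proper_card; apply/properP; split.
    by apply/subsetP => x; rewrite !inE => /andP[-> /ltn_trans->].
  by exists (Ordinal i_n); rewrite !inE ai //= ltnn.
have le i : rank a i <= i.
  rewrite -[i in _ <= i]card_ord -cardsT.
  apply: (@card_le_rel _ _ _ _ (fun (r : 'I_n) (l : 'I_i) => r = l :> nat)) => [r|r r' l].
    by rewrite !inE => /andP[_ ri]; exists (Ordinal ri); rewrite ?inE.
  by move=> _ _ e1 e2; apply/val_inj; rewrite /= e1.
split=> //.
- by move=> i r ir ai _; apply: inc.
- by move=> i r l ir ai _ e; have := inc _ _ ir (leq_ltn_trans (leq0n _) ai); rewrite e ltnn.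
- by move=> i r l ir ai _ _; have := inc _ _ ir (leq_ltn_trans (leq0n _) ai); lia.
- by move=> i r l ir _ ai _; have := inc _ _ ir (leq_ltn_trans (leq0n _) ai); lia.
Qed.

(** The filling by ranks has entries below [k], the number of nonzero rows of [b], so a reversed
    filling of [e] has entries at least [n - k]. Its nonzero rows are therefore among the top [k]
    rows, and their number is [k]. *)
Lemma nonzero_rows_top n (b e : n.-tuple nat) :
    reversible b e -> #|nonzero_rows b| = #|nonzero_rows e| ->
  forall i, i < n -> (0 < nth 0 e i) = (n - #|nonzero_rows b| <= i).
Proof.
move=> be K; set k := #|nonzero_rows b|.
have kn : k <= n by rewrite -[n in _ <= n]card_ord max_card.
have [G VG /(_ (leq k))] := be _ (rank_qkarray b).
have -> : #|[set x : box b | k <= rank b (row x)]| = 0.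
  apply/eqP; rewrite cards_eq0; apply/eqP/setP => x; rewrite !inE leqNgt.
  apply/negbF; apply: proper_card; apply/properP; split.
    by apply/subsetP => r; rewrite inE => /andP[].
  exists (row x); first by rewrite inE; apply: leq_ltn_trans (col_lt x).
  by rewrite !inE ltnn andbF.
move/esym/eqP; rewrite cards_eq0 => /eqP G0.
have top i : 0 < nth 0 e i -> n - k <= i.
  move=> ei; have [y [ry cy]] := box_exists ei.
  have := in_set0 y; rewrite -G0 inE => /negbT; rewrite -ltnNge ry cy => lt.
  by have := qk_le VG ei; lia.
have /eqP E : nonzero_rows e == [set i : 'I_n | n - k <= i].
  rewrite eqEcard; apply/andP; split.
    by apply/subsetP => i; rewrite !inE; apply: top.
  rewrite -K -/k; rewrite -[k in _ <= k]card_ord -cardsT.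
  apply: (@card_le_rel _ _ _ _ (fun (r : 'I_n) (l : 'I_k) => r = (n - k) + l :> nat)).
    move=> r; rewrite inE => h; have lt : r - (n - k) < k by have := ltn_ord r; lia.
    by exists (Ordinal lt); rewrite ?inE //= subnKC.
  by move=> r r' l _ _ e1 e2; apply/val_inj; rewrite /= e1.
by move=> i i_n; have := in_set (fun i : 'I_n => 0 < nth 0 e i) (Ordinal i_n);
  rewrite -/(nonzero_rows e) E inE.
Qed.

(** The map from [i] to [n - (i - j).+1] reflects the interval of rows from [j] to [n - 1]. *)
Definition top_reversal n j (b e : nat -> nat) : Prop :=
  (forall i, i < j \/ n <= i -> b i = 0 /\ e i = 0) /\
  (forall i, j <= i -> i < n -> 0 < b i /\ e (n - (i - j).+1) = b i).

Lemma top_reversal_sym n j b e : j <= n -> top_reversal n j b e -> top_reversal n j e b.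
Proof.
move=> jn [h1 h2]; split=> [i /h1[]//|i ji i_n].
have [] := h2 (n - (i - j).+1); try lia.
have -> : n - (n - (i - j).+1 - j).+1 = i by lia.
by move=> pos ->.
Qed.

Lemma reversible_shape n (b e : n.-tuple nat) :
    reversible b e -> reversible e b ->
  exists2 j, j <= n & top_reversal n j (nth 0 b) (nth 0 e).
Proof.
move=> be eb.
have K : #|nonzero_rows b| = #|nonzero_rows e|.
  by apply/eqP; rewrite eqn_leq !card_nonzero_rows_le.
have te := nonzero_rows_top be K; have tb := nonzero_rows_top eb (esym K).
have [phi [phiP phi_inc]] := reversible_embedding be eb.
rewrite -K in tb; set j := n - _ in te tb; exists j; first exact: leq_subr.
split=> i.
  move=> h; case: (ltnP i n) => c; last by rewrite !len_ge.
  by have := te _ c; have := tb _ c; lia.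
move=> ji i_n; have pos r : j <= r -> r < n -> 0 < nth 0 b r by move=> jr rn; rewrite tb.
split; first exact: pos.
have bi := pos _ ji i_n; have [_ <-] := phiP _ bi; congr nth.
(* [phi] increases strictly from the [n - j] top rows into the values below [n - j], so it is the
   shift by [j]. *)
suff : phi i = i - j by move->.
have up : phi i + j <= i.
  apply: (@increasing_le j n (fun i => phi i + j)) => // [r r' jr rr' rn|r jr rn].
    by rewrite ltn_add2r; apply: phi_inc; rewrite // ?pos //; lia.
  have [le eE] := phiP _ (pos _ jr rn); have := pos _ jr rn.
  by rewrite -eE te; lia.
have low r : j <= r -> r < n -> r <= phi r + j.
  elim: r => [//|r IH] jr rn; case: (ltnP r j) => c; first lia.
  by have := IH c (ltnW rn); have := phi_inc _ _ (ltnSn r) (pos _ c (ltnW rn)) (pos _ jr rn); lia.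
by have := low _ ji i_n; lia.
Qed.

Lemma card_rows_reversal n j (b e : n.-tuple nat) (P Q : pred nat) :
    j <= n -> top_reversal n j (nth 0 b) (nth 0 e) ->
    (forall i, j <= i -> i < n -> P i -> Q (n - (i - j).+1)) ->
  #|[set y : box e | P (row y)]| <= #|[set x : box b | Q (row x)]|.
Proof.
move=> jn /(top_reversal_sym jn)[zero inn] PQ.
apply: (@card_le_rel _ _ _ _ (fun y x =>
  row x = n - (row y - j).+1 :> nat /\ col x = col y)).
  move=> y; rewrite inE => Py.
  have jy : j <= row y.
    rewrite leqNgt; apply/negP => lt; have [e0 _] := zero _ (or_introl lt).
    by have := col_lt y; rewrite e0.
  have [pos bE] := inn _ jy (ltn_ord _).
  have := col_lt y; rewrite -bE => /box_exists[x [rx cx]].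
  by exists x; rewrite // inE rx; apply: PQ.
move=> y y' x _ _ [r1 c1] [r2 c2]; apply: box_inj; last by rewrite -c1.
have jy (z : box e) : j <= row z.
  rewrite leqNgt; apply/negP => lt; have [e0 _] := zero _ (or_introl lt).
  by have := col_lt z; rewrite e0.
have := jy y; have := jy y'; have := ltn_ord (row y); have := ltn_ord (row y'); lia.
Qed.

(** * Explicit fillings that exclude forbidden steps *)

Definition lower_last_box (a : nat -> nat) j i (r l : nat) : nat :=
  if (r == i.+1) && (l.+1 == a i.+1) then i - j else r - j.

(** Because of the gap of two, row [i] reaches neither the last column of row [i.+1], where its
    value would be repeated, nor the column before, where its entry would complete a type B
    violation. *)
Lemma lower_last_box_qkarray (a : nat -> nat) j i :
    (forall r, 0 < a r -> j <= r) -> j <= i -> 0 < a i -> a i + 2 <= a i.+1 ->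
  qkarray a (lower_last_box a j i).
Proof.
move=> aj ji ai step; rewrite /lower_last_box.
have ri r : r = i -> a r = a i by move->.
have ri1 r : r = i.+1 -> a r = a i.+1 by move->.
split.
- by move=> r l h; have := aj r; have := ri1 r; do !case: ifP; lia.
- by move=> r l h; case: ifP; lia.
- by move=> r r' rr h h'; have := aj r; have := aj r'; do !case: ifP; lia.
- move=> r r' l rr h h'; have := aj r; have := aj r'.
  by have := ri r; have := ri r'; do !case: ifP; lia.
- move=> r r' l rr h h'; have := aj r; have := aj r'.
  by have := ri r; have := ri r'; have := ri1 r; have := ri1 r'; do !case: ifP; lia.
- move=> r r' l rr h h'; have := aj r; have := aj r'.
  by have := ri r; have := ri r'; have := ri1 r; have := ri1 r'; do !case: ifP; lia.
Qed.

(** Raising the rows from [i] on by one, possible for [0 < j], frees the value [i - j], which is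
    then used once, at the end of row [i.+1]. *)
Definition shifted_rows (a : nat -> nat) j i (r l : nat) : nat :=
  if (r == i.+1) && (l.+1 == a i.+1) then i - j else r - j + (i <= r).

Lemma shifted_rows_qkarray (a : nat -> nat) j i :
    (forall r, 0 < a r -> j <= r) -> 0 < j -> j <= i -> 1 < a i.+1 -> a i = (a i.+1).+1 ->
  qkarray a (shifted_rows a j i).
Proof.
move=> aj j0 ji ai step; rewrite /shifted_rows.
have ri r : r = i -> a r = a i by move->.
have ri1 r : r = i.+1 -> a r = a i.+1 by move->.
split.
- by move=> r l h; have := aj r; have := ri1 r; do !case: ifP; lia.
- by move=> r l h; have := aj r; case: ifP; lia.
- by move=> r r' rr h h'; have := aj r; have := aj r'; do !case: ifP; lia.
- move=> r r' l rr h h'; have := aj r; have := aj r'.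
  by have := ri r; have := ri r'; do !case: ifP; lia.
- move=> r r' l rr h h'; have := aj r; have := aj r'.
  by have := ri r; have := ri r'; have := ri1 r; have := ri1 r'; do !case: ifP; lia.
- move=> r r' l rr h h'; have := aj r; have := aj r'.
  by have := ri r; have := ri r'; have := ri1 r; have := ri1 r'; do !case: ifP; lia.
Qed.

Lemma top_reversal_le n j b e i : top_reversal n j b e -> 0 < b i -> j <= i.
Proof. by case=> zero _; case: (ltnP i j) => // lt; have [->] := zero i (or_introl lt). Qed.

(* Lowering the last box of row [i.+1] to the value of row [i] puts more entries
   [<= i - j] in [b] than the rows of [e] can hold after reversal. *)
Lemma reversible_up n j (b e : n.-tuple nat) i :
    j <= n -> top_reversal n j (nth 0 b) (nth 0 e) -> reversible b e ->
    j <= i -> i.+1 < n ->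
  nth 0 b i.+1 <= (nth 0 b i).+1.
Proof.
move=> jn tr be ji i_n; rewrite leqNgt; apply/negP => step.
have bj r : 0 < nth 0 b r -> j <= r by apply: top_reversal_le tr.
have [bi _] := tr.2 i ji (ltnW i_n).
have VF : qkarray (nth 0 b) (lower_last_box (nth 0 b) j i).
  by apply: lower_last_box_qkarray => //; lia.
have [G VG /(_ (fun v => v <= i - j)) GE] := be _ VF.
have b1 : (nth 0 b i.+1).-1 < nth 0 b i.+1 by lia.
have [x [rx cx]] := box_exists b1.
have : #|x |: [set x : box b | row x <= i]| <= #|[set y : box e | n - (i - j).+1 <= row y]|.
  apply: (@leq_trans #|[set y : box e | n - (G (row y) (col y)).+1 <= i - j]|).
    rewrite -GE; apply: subset_leq_card; apply/subsetP => z; rewrite !inE.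
    case/orP=> [/eqP->|]; rewrite /lower_last_box; last by case: ifP; lia.
    by rewrite rx cx eqxx prednK ?eqxx //; lia.
  apply: subset_leq_card; apply/subsetP => y; rewrite !inE.
  by have := qk_le VG (col_lt y); have := ltn_ord (row y); lia.
(* By reflection, the boxes counted on the right are at most those of [b] in rows up to [i]; the
   left side has one more. *)
rewrite cardsU1 inE rx ltnn /= add1n ltnNge.
rewrite (@card_rows_reversal n j b e (leq (n - (i - j).+1)) (geq i)) //.
by move=> r jr rn; rewrite /geq /=; lia.
Qed.

(* In a filling of [e] whose content is the reverse of that of [shifted_rows],
   rows [I.+1] and [I] would carry the type B triple [I.+1 >= I >= I]. *)
Lemma reversible_down n j (b e : n.-tuple nat) i :
    j <= n -> top_reversal n j (nth 0 b) (nth 0 e) -> reversible b e ->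
    0 < j -> j <= i -> i.+1 < n -> 1 < nth 0 b i.+1 ->
  nth 0 b i <> (nth 0 b i.+1).+1.
Proof.
move=> jn tr be j0 ji i_n b1 step; set m := nth 0 b i.+1 in b1 step.
have bj r : 0 < nth 0 b r -> j <= r by apply: top_reversal_le tr.
have VF : qkarray (nth 0 b) (shifted_rows (nth 0 b) j i) by apply: shifted_rows_qkarray.
have [G VG GE] := be _ VF.
(* [I] and [I.+1] are the reflections of the rows [i.+1] and [i], and also the reversals of the
   values [(i - j).+1] and [i - j]. *)
pose I := n - (i - j).+2; have IE : I = n - (i - j).+2 by [].
have eI : nth 0 e I = m.
  by rewrite /m; have [_ <-] := tr.2 i.+1 (leqW ji) i_n; congr nth; lia.
have eI1 : nth 0 e I.+1 = m.+1.
  by have [_] := tr.2 i ji (ltnW i_n); rewrite step => <-; congr nth; lia.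
(* Entries above [I.+1] lie in rows above [I.+1], and counting the entries below [i - j] in [b]
   shows that they fill these rows. Hence [I] and [I.+1] occur only in rows [I] and [I.+1]. *)
have high (y : box e) : I.+1 < row y -> I.+1 < G (row y) (col y).
  have : [set y : box e | I.+1 < G (row y) (col y)] == [set y : box e | I.+1 < row y].
    rewrite eqEcard; apply/andP; split.
      by apply/subsetP => z; rewrite !inE => lt; apply: (leq_trans lt (qk_le VG (col_lt z))).
    apply: (@leq_trans #|[set x : box b | row x < i]|).
      by apply: (@card_rows_reversal n j b e (leq I.+2) (fun r => r < i)) => // r; lia.
    apply: (@leq_trans #|[set x : box b | shifted_rows (nth 0 b) j i (row x) (col x) < i - j]|).
      apply: subset_leq_card; apply/subsetP => x; rewrite !inE /shifted_rows.
      have := bj (row x) (leq_ltn_trans (leq0n _) (col_lt x)).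
      by case: ifP; lia.
    rewrite (GE (fun v => v < i - j)); apply: subset_leq_card; apply/subsetP => z.
    by rewrite !inE; have := val_at_lt VG z; lia.
  by move/eqP/setP/(_ y); rewrite !inE => ->.
have rowI (y : box e) : I <= G (row y) (col y) -> G (row y) (col y) <= I.+1 -> I <= row y <= I.+1.
  by have := high y; have := qk_le VG (col_lt y); lia.
have [y1 y1E] : exists y1, [set y : box e | G (row y) (col y) == I.+1] = [set y1].
  apply/cards1P.
  have := GE (pred1 (i - j)); set lhs := #|_|.
  have -> : lhs = 1.
    have [x [rx cx]] := @box_exists n b i.+1 m.-1 ltac:(rewrite -/m; lia).
    apply/eqP/cards1P; exists x; apply/setP => z; rewrite !inE /= /shifted_rows.
    have pz := bj (row z) (leq_ltn_trans (leq0n _) (col_lt z)).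
    apply/eqP/eqP => [|->]; last by rewrite rx cx -/m prednK ?eqxx //; lia.
    case: ifP => [/andP[/eqP rz /eqP cz] _|_]; last lia.
    by apply: box_inj; rewrite ?rx ?rz // cx /m -cz.
  move=> ->; apply/eqP; apply: eq_card => y; rewrite !inE /=.
  by have := val_at_lt VG y; lia.
have y1v : G (row y1) (col y1) = I.+1.
  by have := set11 y1; rewrite -y1E inE => /eqP.
have y1_unique (y : box e) : G (row y) (col y) = I.+1 -> y = y1.
  by move=> yv; apply/set1P; rewrite -y1E inE yv.
have ry1 : row y1 = I.+1 :> nat.
  by have := rowI y1; have := qk_le VG (col_lt y1); rewrite y1v; lia.
have pos1 : 0 < nth 0 e I.+1 by rewrite eI1.
(* The single entry [I.+1] lies in row [I.+1]; rows decrease and the row bound is [I.+1], so it is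
   the first entry of that row. *)
have G10 : G I.+1 0 = I.+1.
  have := qk_le VG pos1; have := qk_row_le VG (leq0n (col y1)) (col_lt y1).
  by rewrite y1v ry1; lia.
have cy1 : col y1 = 0.
  by have [y [ry cy]] := box_exists pos1; rewrite -(y1_unique y) ?ry ?cy.
have G11 : G I.+1 1 <> I.+1.
  have h : 1 < nth 0 e I.+1 by rewrite eI1; lia.
  have [y [ry cy]] := box_exists h; rewrite -{1}ry -cy => /y1_unique e1.
  by move: cy; rewrite e1 cy1.
pose A := [set y : box e | G (row y) (col y) == I].
have Acol y : y \in A -> G (row y) (col y) = I /\ col y < m.+1.
  rewrite inE => /eqP yv; split=> //; have := rowI y; rewrite yv leqnSn leqnn => /(_ isT isT).
  have := col_lt y; case: (ltngtP (row y : nat) I) => // [h|->]; last by rewrite eI; lia.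
  by move=> cl /andP[_ h']; have ry : row y = I.+1 :> nat by [lia]; rewrite ry eI1 in cl.
have Acard : m < #|A|.
  have -> : #|A| = #|[set x : box b | shifted_rows (nth 0 b) j i (row x) (col x) == (i - j).+1]|.
    rewrite (GE (pred1 (i - j).+1)); apply: eq_card => y; rewrite !inE /=.
    by have := val_at_lt VG y; lia.
  rewrite -step -card_row; apply: subset_leq_card; apply/subsetP => x.
  by rewrite !inE /shifted_rows => /eqP->; case: ifP; lia.
(* The value [I] occurs in each of the columns [0] to [m]: in column [0] it must be in row [I], as
   row [I.+1] starts with [I.+1], and in column [m] it must be in row [I.+1], as row [I] is too
   short. *)
have [y0 /[dup] /Acol[y0v _] _ cy0] := value_all_cols VG Acol Acard (ltn0Sn m).
have [ym /[dup] /Acol[ymv _] _ cym] := value_all_cols VG Acol Acard (ltnSn m).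
have ry0 : row y0 = I :> nat.
  have := rowI y0; rewrite y0v leqnSn leqnn => /(_ isT isT).
  case: (ltngtP (row y0 : nat) I) => // h h'.
  have ry : row y0 = I.+1 :> nat by lia.
  by move: y0v; rewrite ry cy0 G10; lia.
have rym : row ym = I.+1 :> nat.
  have := rowI ym; rewrite ymv leqnSn leqnn => /(_ isT isT).
  case: (ltngtP (row ym : nat) I) => // [h h'|h]; first lia.
  by have := col_lt ym; rewrite cym h eI ltnn.
have h1 : 1 < nth 0 e I.+1 by rewrite eI1; lia.
have h0 : 0 < nth 0 e I by rewrite eI; lia.
apply: (qk_B VG (ltnSn I) h1 h0); first by rewrite eI eI1.
have hm : m < nth 0 e I.+1 by rewrite eI1.
have := qk_row_le VG (ltnW b1) hm; have := qk_row VG h1.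
move: y0v ymv; rewrite ry0 cy0 rym cym; lia.
Qed.

Theorem mainTheorem14 (n : nat) (p : {mpoly int[n]}) :
  ((exists b : n.-tuple nat, p = quasikey b) /\
   (exists c : n.-tuple nat, p = young_quasikey c))
  <->
  (exists a : n.-tuple nat,
     p = young_quasikey a /\
     (equal_parts_then_zeros a \/
      ones_twos_then_zeros a \/
      no_zero_small_steps a)).
Proof.
split=> [[[b pb] [c pc]]|[a [pa cond]]]; last first.
  split; last by exists a.
  case: cond => [/equal_parts_quasikey[b e]|[/ones_twos_quasikey[b e]|/small_steps_quasikey e]].
  - by exists b; rewrite e.
  - by exists b; rewrite e.
  - by exists a; rewrite e.
exists c; split=> //; pose e := [tuple of rev c].
have /quasikey_eq_youngP bc : quasikey b = young_quasikey c by rewrite -pb.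
have be : reversible b e by apply: mcoeff_reversible.
have eb : reversible e b by apply: mcoeff_reversible => m; rewrite bc revmK.
have [j jn tr] := reversible_shape be eb; have tr' := top_reversal_sym jn tr.
pose k := n - j; have kE : k = n - j by [].
have ce i : i < n -> nth 0 e (n - i.+1) = nth 0 c i by apply: nth_revK.
have cpos i : i < k -> 0 < nth 0 c i.
  move=> ik; rewrite -ce; last lia.
  by have [] := tr'.2 (n - i.+1); lia.
have czero i : k <= i -> nth 0 c i = 0.
  move=> ki; case: (ltnP i n) => i_n; last by rewrite len_ge.
  rewrite -ce //; have h : n - i.+1 < j by lia.
  by have [] := tr'.1 _ (or_introl h).
have cb i : i < k -> nth 0 b (j + i) = nth 0 c i.
  move=> ik; have [||_] := tr.2 (j + i); try lia.
  by rewrite addKn ce; lia.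
have up i : i.+1 < k -> nth 0 c i.+1 <= (nth 0 c i).+1.
  move=> ik; rewrite -!cb; try lia.
  by rewrite addnS; apply: (reversible_up jn tr be); lia.
(* A descent of [c] is an ascent of its reversal [e]. *)
have up' i : i.+1 < k -> nth 0 c i <= (nth 0 c i.+1).+1.
  move=> ik; rewrite -!ce; try lia.
  have -> : n - i.+1 = (n - i.+2).+1 by lia.
  by apply: (reversible_up jn tr' eb); lia.
have cE : c = take k c ++ nseq j 0 :> seq nat.
  rewrite -{1}(cat_take_drop k c); congr (_ ++ _).
  apply: (@eq_from_nth _ 0) => [|i]; rewrite size_drop size_tuple ?size_nseq; first lia.
  by move=> ij; rewrite nth_drop nth_nseq czero ?if_same ?leq_addr.
have size_take_k : size (take k c) = k by rewrite size_takel // size_tuple; lia.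
have nth_k i : i < k -> nth 0 (take k c) i = nth 0 c i by move=> ik; rewrite nth_take.
case: (posnP j) => j0.
  right; right; split.
    apply/(nthP 0) => -[i]; rewrite size_tuple => i_n c0.
    by have := cpos i; rewrite c0; lia.
  apply/(sortedP 0) => i; rewrite size_tuple => i_n.
  by rewrite up ?up' //; lia.
(* From here on there is a zero, so unequal neighbours can only be 1 and 2. *)
have adj i : i.+1 < k -> nth 0 c i = nth 0 c i.+1 \/
    nth 0 c i \in [:: 1; 2] /\ nth 0 c i.+1 \in [:: 1; 2].
  move=> ik; rewrite !inE; have := up i ik; have := up' i ik.
  have := cpos i (ltnW ik); have := cpos i.+1 ik.
  have d1 : 1 < nth 0 c i.+1 -> nth 0 c i <> (nth 0 c i.+1).+1.
    rewrite -!cb; try lia.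
    by rewrite addnS => ?; apply: (reversible_down jn tr be); lia.
  have d2 : 1 < nth 0 c i -> nth 0 c i.+1 <> (nth 0 c i).+1.
    rewrite -!ce; try lia.
    have -> : n - i.+1 = (n - i.+2).+1 by lia.
    by move=> ?; apply: (reversible_down jn tr' eb); lia.
  lia.
(* By [adj], a first part 1 or 2 keeps all nonzero parts in that set, and any other first part is
   repeated throughout. *)
case: (boolP (nth 0 c 0 \in [:: 1; 2])) => c0.
  right; left; exists (take k c), j; split=> //.
  apply/(all_nthP 0) => i; rewrite size_take_k => ik; rewrite nth_k //.
  suff : nth 0 c i \in [:: 1; 2] by rewrite !inE.
  elim: i ik => [//|i IH] ik.
  by case: (adj i ik) => [<-|[]//]; apply: IH; apply: ltnW.
left; exists k, (nth 0 c 0), j; rewrite {1}cE; congr (_ ++ _).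
apply: (@eq_from_nth _ 0) => [|i]; rewrite size_take_k ?size_nseq // => ik.
rewrite nth_k // nth_nseq ik; elim: i ik => [//|i IH] ik.
case: (adj i ik) => [<-|[h _]]; first by apply: IH; apply: ltnW.
by move: h; rewrite IH ?(ltnW ik) // (negbTE c0).
Qed.
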